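(* Let $H^{231}:\mathcal E\to[0,\infty]$ be defined by $$H^{231}(\varphi):=2\int_{[0,1]}J(\varphi'(t))\,\mathrm dt .$$ For all $n\ge1$, let $\sigma_{n,231}$ be a uniform random $231$-avoiding permutation of size $n$. Then the random variables $(\varphi_{\sigma_{n,231}})_{n\ge1}$ satisfy a large deviation principle on $\mathcal E$ at speed $n$ with rate function $H^{231}$.
   Context: $\mathcal E$ is the set of $1$-Lipschitz functions $\varphi:[0,1]\to[0,\infty)$ with $\varphi(0)=\varphi(1)=0$, with the supremum norm topology (it is compact). Elements of $\mathcal E$ are a.e. differentiable with $|\varphi'|\le1$. For $y\in[-1,1]$, $J(y):=\frac12(1+y)\log(1+y)+\frac12(1-y)\log(1-y)$, with $0\log0=0$. A permutation $\sigma$ of $\{1,\dots,n\}$ is $231$-avoiding if there are no $i<j<k$ with $\sigma(k)<\sigma(i)<\sigma(j)$. For such $\sigma$, define the normalized RLM-curve (right-to-left-minima curve) by $f_\sigma(x):=\frac1n\big(\min\{\sigma(c):c>nx\}-1\big)$ for $x\in[0,1)$ and $f_\sigma(1):=1$. This is a càdlàg nondecreasing function with $f_\sigma(x)\le x$. Its completed graph is $G_{f_\sigma}=\{(x,y)\in[0,1]^2:f_\sigma(x^-)\le y\le f_\sigma(x)\}$ (convention $f_\sigma(0^-)=0$), and $\varphi_\sigma\in\mathcal E$ is the function obtained by rotating this graph by $-\pi/4$, flipping it and scaling it down by $\sqrt2$, i.e. the unique function with $G_{f_\sigma}=\{(t+\varphi_\sigma(t),t-\varphi_\sigma(t)):t\in[0,1]\}$.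 A sequence $(X_n)$ of random variables in a Polish space $E$ satisfies a large deviation principle at speed $a_n\to\infty$ with rate function $I:E\to[0,\infty]$ (lower semicontinuous) if $\limsup_n\frac1{a_n}\log\mathbb P(X_n\in F)\le-\inf_FI$ for every closed $F\subseteq E$ and $\liminf_n\frac1{a_n}\log\mathbb P(X_n\in O)\ge-\inf_OI$ for every open $O\subseteq E$. *)

(* Defs.v *)
From HB Require Import structures.
From mathcomp Require Import all_boot all_order all_algebra perm lra.
From mathcomp Require Import all_classical all_reals all_analysis.

Set Implicit Arguments.
Unset Strict Implicit.
Unset Printing Implicit Defensive.

Import Order.TTheory GRing.Theory Num.Theory.
Import numFieldNormedType.Exports.

Local Open Scope classical_set_scope.
Local Open Scope ring_scope.

(* Functions on [0,1] are represented by their extension by 0 to R, which makes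
   the representation unique and gives access to derivatives on R. *)
Record excursion (R : realType) := Excursion {
  excursion_fun :> R -> R;
  excursion_lip : 1.-lipschitz_`[0, 1] excursion_fun;
  excursion_ge0 : forall t : R, t \in `[0, 1] -> 0 <= excursion_fun t;
  excursion_at0 : excursion_fun 0 = 0;
  excursion_at1 : excursion_fun 1 = 0;
  excursion_out : forall t : R, t \notin `[0, 1] -> excursion_fun t = 0 }.

HB.instance Definition _ (R : realType) := gen_eqMixin (excursion R).
HB.instance Definition _ (R : realType) := gen_choiceMixin (excursion R).

Section excursion_topology.
Variable R : realType.
Implicit Types phi psi chi : excursion R.

Lemma excursion_inj phi psi : excursion_fun phi = excursion_fun psi -> phi = psi.
Proof.
case: phi psi => [f a b c d e] [g a' b' c' d' e'] /= fg.
by case: _ / fg in a' b' c' d' e' *; congr Excursion; exact: Prop_irrelevance.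
Qed.

Definition excursion0 : excursion R.
Proof.
by exists (fun=> 0) => // xy _ /=; rewrite subrr normr0 mulr_ge0.
Defined.

HB.instance Definition _ := isPointed.Build (excursion R) excursion0.

Lemma excursion_le1 phi t : 0 <= phi t <= 1.
Proof.
have [t01|/excursion_out ->] := boolP (t \in `[0, 1]); last by rewrite lexx ler01.
rewrite excursion_ge0//=; have := t01; rewrite in_itv/= => /andP[t0 t1].
have := @excursion_lip _ phi (t, 0); rewrite /= excursion_at0 !subr0 mul1r.
rewrite !in_itv/= lexx ler01 t0 t1 => /(_ (conj erefl erefl)).
by move=> /(le_trans (ler_norm _)) /le_trans; apply; rewrite ger0_norm.
Qed.

Definition sup_dist phi psi : R :=
  sup [set `|phi t - psi t| | t in `[0, 1]].

Let has_sup_dist phi psi : has_sup [set `|phi t - psi t| | t in `[0, 1]].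
Proof.
split; first by exists `|phi 0 - psi 0|; exists 0; rewrite //= in_itv/= lexx ler01.
exists 1 => _ [t _ <-]; rewrite ler_norml.
have /andP[? ?] := excursion_le1 phi t; have /andP[? ?] := excursion_le1 psi t.
by apply/andP; split; lra.
Qed.

Let le_sup_dist phi psi t : `|phi t - psi t| <= sup_dist phi psi.
Proof.
have [t01|t01] := boolP (t \in `[0, 1]).
  by apply: sup_upper_bound; [exact: has_sup_dist|exists t].
rewrite !excursion_out// subrr normr0.
apply: (@le_trans _ _ `|phi 0 - psi 0|) => //.
apply: sup_upper_bound; first exact: has_sup_dist.
by exists 0 => //; rewrite /= in_itv/= lexx ler01.
Qed.

Let sup_dist_le phi psi (M : R) :
  (forall t, `|phi t - psi t| <= M) -> sup_dist phi psi <= M.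
Proof.
move=> H; apply: ge_sup; first by have [] := has_sup_dist phi psi.
by move=> _ [t _ <-].
Qed.

Let sup_distxx phi : sup_dist phi phi = 0.
Proof.
apply/eqP; rewrite eq_le sup_dist_le/=; last by move=> t; rewrite subrr normr0.
by rewrite (le_trans _ (le_sup_dist _ _ 0)).
Qed.

Let sup_dist_positivity phi psi : sup_dist phi psi = 0 -> phi = psi.
Proof.
move=> H; apply: excursion_inj; apply/funext => t; apply/eqP.
by rewrite -subr_eq0 -normr_le0 -H le_sup_dist.
Qed.

Let sup_dist_sym phi psi : sup_dist phi psi = sup_dist psi phi.
Proof.
by rewrite /sup_dist; congr sup; apply: eq_imagel => t _; rewrite distrC.
Qed.

Let sup_dist_triangle psi phi chi :
  sup_dist phi chi <= sup_dist phi psi + sup_dist psi chi.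
Proof.
apply: sup_dist_le => t; rewrite (le_trans (ler_distD (psi t) _ _))//.
by rewrite lerD// le_sup_dist.
Qed.

HB.instance Definition _ := isMetric.Build R (excursion R)
  sup_distxx sup_dist_positivity sup_dist_sym sup_dist_triangle.

End excursion_topology.

(* [ln 0 = 0] in the library, so that 0 log 0 = 0 as required. *)
Definition J (R : realType) (y : R) : R :=
  2^-1 * ((1 + y) * ln (1 + y)) + 2^-1 * ((1 - y) * ln (1 - y)).

(* A Lipschitz function is differentiable almost everywhere, so that the value
   of the total operator [derive1] at the other points does not matter. *)
Definition H231 (R : realType) (phi : excursion R) : \bar R :=
  (2%:E * \int[lebesgue_measure]_(t in `[0%R, 1%R]) (J (derive1 phi t))%:E)%E.

Section permutations.
Local Open Scope nat_scope.

Definition avoids231 n (s : 'S_n) : bool :=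
  [forall i : 'I_n, forall j : 'I_n, forall k : 'I_n,
    ~~ [&& i < j, j < k, s k < s i & s i < s j]].

Lemma avoids231_id n : avoids231 (1%g : 'S_n).
Proof.
apply/forallP => i; apply/forallP => j; apply/forallP => k.
apply/negP => /and4P[ij jk]; rewrite !perm1 => ki _.
by have := ltn_trans (ltn_trans ij jk) ki; rewrite ltnn.
Qed.

Definition Av231 (n : nat) := {s : 'S_n | avoids231 s}.

HB.instance Definition _ n := Finite.on (Av231 n).
HB.instance Definition _ n :=
  isPointed.Build (Av231 n) (exist _ 1%g (avoids231_id n)).
HB.instance Definition _ n := @isMeasurable.Build default_measure_display
  (Av231 n) discrete_measurable discrete_measurable0
  discrete_measurableC discrete_measurableU.

End permutations.

(* The second argument of [mnormalize] is only a default for when the total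
   mass is 0 or +oo; here the total mass is the number of avoiders. *)
Definition unif231 (R : realType) (n : nat) : probability (Av231 n) R :=
  mnormalize (@counting (Av231 n) R) (dirac point).

(* Positions and values range over 'I_n = {0, ..., n-1}: the 1-based position
   of [i] is [i.+1], and the 0-based value [s i] is the 1-based value minus 1.
   For x < 1 the minimum is over a nonempty set and its default n is immaterial. *)
Definition rlm_curve (R : realType) n (s : 'S_n) (x : R) : R :=
  if x < 1 then
    (\big[minn/n]_(i < n | (n%:R * x < i.+1%:R :> R)%R) s i)%:R / n%:R
  else 1.

Definition left_limit (R : realType) (f : R -> R) (x : R) : R :=
  if x == 0 then 0 else lim (f z @[z --> x^'-]).

Definition completed_graph (R : realType) (f : R -> R) : set (R * R) :=
  [set p | [/\ p.1 \in `[0, 1], p.2 \in `[0, 1] &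
               left_limit f p.1 <= p.2 <= f p.1]].

(* [xget] picks the excursion with the given graph, which exists and is unique
   when n > 0. *)
Definition rotated_curve (R : realType) n (s : 'S_n) : excursion R :=
  xget (@excursion0 R) [set phi : excursion R |
    completed_graph (rlm_curve s) =
      [set (t + phi t, t - phi t) | t in `[0, 1]]].

(* [lne 0 = -oo] and [ereal_inf set0 = +oo]. *)
Definition satisfies_LDP (R : realType) (E : topologicalType)
    (d : measure_display) (T : nat -> measurableType d)
    (P : forall n, probability (T n) R) (X : forall n, T n -> E)
    (a : nat -> R) (I : E -> \bar R) : Prop :=
  [/\ forall n (O : set E), open O -> measurable (X n @^-1` O),
      a n @[n --> \oo] --> +oo,
      (forall x, 0 <= I x)%E /\ lower_semicontinuous I,
      forall F : set E, closed F ->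
        (limn_esup (fun n => (a n)^-1%:E * lne (P n (X n @^-1` F)))
           <= - ereal_inf (I @` F))%E &
      forall O : set E, open O ->
        (- ereal_inf (I @` O)
           <= limn_einf (fun n => (a n)^-1%:E * lne (P n (X n @^-1` O))))%E].

(* Main.v *)
Require Import Defs.
From HB Require Import structures.
From mathcomp Require Import all_boot all_order all_algebra perm.
From mathcomp Require Import ring lra zify.
From mathcomp Require Import all_classical all_reals all_analysis.
From mathcomp Require Import measurable_realfun.

(** The curve of a 231-avoiding permutation of size [n] is a rescaled Dyck path
    of length [2 * n], and every Dyck path arises from exactly one avoider
    ([rlm_word_inj], [rlm_word_surj], [rotated_curve_lattice]): the prefix of
    the path before the [k]-th East step has as many North steps as the least
    entry from position [k] on, and stack sorting reconstructs the permutation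
    from these minima.  The statement is therefore Mogulskii's theorem for
    uniform Dyck paths, and it is proved by counting.

    Cut the time interval into [N] equal blocks.  The number of words with
    prescribed increments over the blocks is a product of binomial
    coefficients, hence [exp (2 n log 2 - n * rate)] up to a polynomial factor,
    where the rate is a Riemann-type sum of [J] over the slopes
    ([discrete_rate]).  As there are polynomially many possible increments, this
    gives an upper bound for the number of avoiders whose discretized rate
    exceeds [a] ([count_avoiders_rate_ge]).  For a lower bound near a given
    excursion [phi], prescribe increments close to those of
    [max (phi, min (delta, t, 1 - t))] with [delta] of the order of [1 / N]: a
    path with such increments is nonnegative whatever it does inside the blocks,
    because it can only move by the length of a block, and it stays close to
    [phi] for the same reason ([count_avoiders_near]).  For [phi = 0] this lower
    bound also gives the growth rate 4 of the number of all avoiders.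

    The passage from discretized rates to [H231] needs that
    [discrete_rate N phi] is at most [H231 phi] (Jensen's inequality) and comes
    arbitrarily close to it (Fatou's lemma).  Both rest on Lebesgue's theorem
    that a Lipschitz function is almost everywhere differentiable and is the
    integral of its derivative ([excursion_ae_derivative]), which is obtained
    here from the Radon-Nikodym theorem and the Lebesgue differentiation
    theorem.  The open sets [a < discrete_rate N phi] then cover any closed set
    on which [H231 > a], and by compactness of the space of excursions
    ([excursion_compact]) finitely many of them suffice, which gives the upper
    bound; the same sets show that [H231] is lower semicontinuous. *)

Set Implicit Arguments.
Unset Strict Implicit.
Unset Printing Implicit Defensive.

Import Order.TTheory GRing.Theory Num.Theory.
Import numFieldNormedType.Exports.

Local Open Scope classical_set_scope.
Local Open Scope ring_scope.

(** * Convexity and modulus of continuity of the rate density *)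

Section rate_density.
Variable R : realType.
Implicit Types x y z s t a b : R.

(** Since [ln u <= u - 1] at [u = z / x]; for [x = 0] the product [x * ln x] is 0
    as wanted. *)
Lemma xlnx_tangent x z : 0 <= x -> 0 < z -> x - z + x * ln z <= x * ln x.
Proof.
move=> x0 z0; move: x0; rewrite le_eqVlt => /predU1P[<-|x0].
  by rewrite !mul0r add0r addr0 oppr_le0 ltW.
have : ln (1 + (z / x - 1)) <= z / x - 1.
  by apply: le_ln1Dx; rewrite ltrBrDl subrr divr_gt0.
rewrite addrCA subrr addr0 ln_div ?posrE// -(ler_pM2l x0).
by rewrite !mulrBr mulrCA divff ?gt_eqF// !mulr1; lra.
Qed.

(** Outside [-1, 1] one of the two logarithms has a nonpositive argument, hence
    the value 0, and the other term is nonnegative. *)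
Lemma J_ge0 y : 0 <= J y.
Proof.
have pos a : 1 <= a -> 0 <= J a.
  move=> a1; rewrite /J (@ln0 _ (1 - a)) ?subr_le0// !mulr0 addr0.
  by rewrite mulr_ge0// mulr_ge0//; [|rewrite ln_ge0//]; lra.
have [/pos//|y1] := leP 1 y.
have [/pos|yN1] := leP 1 (- y).
  by rewrite /J opprK addrC.
have := @xlnx_tangent (1 + y) 1; have := @xlnx_tangent (1 - y) 1.
rewrite ln1 /J; lra.
Qed.

(** The difference of the two sides is a relative entropy between the laws of two
    signs with means [y] and [s]. *)
Lemma J_tangent s y : `|s| < 1 -> `|y| <= 1 ->
  J s + 2^-1 * (ln (1 + s) - ln (1 - s)) * (y - s) <= J y.
Proof.
rewrite ltr_norml ler_norml => /andP[s1 s2] /andP[y1 y2].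
have := @xlnx_tangent (1 + y) (1 + s); have := @xlnx_tangent (1 - y) (1 - s).
rewrite /J; set u := ln (1 + s); set v := ln (1 - s).
by move=> /(_ _ _)/wrap[]; [lra|lra|move=> h1 /(_ _ _)/wrap[]; [lra|lra|nra]].
Qed.

Lemma JN y : J (- y) = J y.
Proof. by rewrite /J opprK addrC. Qed.

Lemma J0 : J (0 : R) = 0.
Proof. by rewrite /J addr0 subr0 ln1 !mulr0 addr0. Qed.

Lemma J1 : J (1 : R) = ln 2.
Proof. by rewrite /J subrr mul0r mulr0 addr0 mulrA mulVf// mul1r. Qed.

Lemma J_norm y : J `|y| = J y.
Proof. by have [y0|y0] := leP 0 y; [rewrite ger0_norm|rewrite ltr0_norm// JN]. Qed.

(** [J] is even, and its tangents on [0, 1[ have nonnegative slopes. *)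
Lemma J_le_norm a b : `|a| <= `|b| -> `|b| <= 1 -> J a <= J b.
Proof.
rewrite -(J_norm a) -(J_norm b).
have := normr_ge0 a; move: `|a| `|b| => {}a {}b a0 ab b1.
have [a1|a1] := leP 1 a; first by have -> : a = b by lra.
have na : `|a| < 1 by rewrite ger0_norm.
have nb : `|b| <= 1 by rewrite ger0_norm//; lra.
apply: le_trans (J_tangent na nb); rewrite lerDl mulr_ge0//; last lra.
by rewrite mulr_ge0// subr_ge0 ler_ln ?posrE; lra.
Qed.

Lemma J_le_ln2 y : `|y| <= 1 -> J y <= ln 2.
Proof. by move=> y1; rewrite -J1 J_le_norm// normr1. Qed.

Lemma ln2_le1 : ln 2 <= 1 :> R.
Proof. by have := @le_ln1Dx R 1; apply; lra. Qed.

Lemma xlnx_ge_sqrt x : 0 <= x -> - (2 * Num.sqrt x) <= x * ln x.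
Proof.
rewrite le_eqVlt => /predU1P[<-|x0]; first by rewrite sqrtr0 mul0r; lra.
have s0 : 0 < Num.sqrt x by rewrite sqrtr_gt0.
have /esym xE := sqr_sqrtr (ltW x0); rewrite expr2 in xE.
have := xlnx_tangent (ltW s0) ltr01; rewrite ln1 mulr0 addr0.
rewrite -subr_ge0 => h; rewrite -subr_ge0 {1 2}xE lnM ?posrE//.
move: h s0; set s := Num.sqrt x => h s0.
have : 0 <= s * (s * ln s - (s - 1)) by rewrite mulr_ge0// ltW.
nra.
Qed.

(** The derivative of [x ln x] is unbounded near 0 only, where [x ln x] is
    comparable to a square root. *)
Lemma xlnx_modulus x y : 0 <= x -> x <= y -> y <= 2 ->
  `|y * ln y - x * ln x| <= 2 * (y - x) + 2 * Num.sqrt (y - x).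
Proof.
move=> x0 xy y2; have [->|neq] := eqVneq x y.
  by rewrite !subrr normr0 sqrtr0 mulr0 addr0.
have {neq}xy : x < y by rewrite lt_neqAle neq.
have h0 : 0 < y - x by rewrite subr_gt0.
have sq0 : 0 <= Num.sqrt (y - x) := sqrtr_ge0 _.
have y0 : 0 < y by lra.
have lny : ln y <= 1.
  by apply: le_trans ln2_le1; rewrite ler_ln ?posrE//; lra.
(* Upper bound: the tangent at [y] compares [x ln y] with [x ln x]. *)
have up := xlnx_tangent x0 y0.
(* Lower bound: [x ln x <= x ln y], and [ln y >= ln (y - x)]. *)
have low : x * ln x <= x * ln y.
  move: x0; rewrite le_eqVlt => /predU1P[<-|x0]; first by rewrite !mul0r.
  by rewrite ler_pM2l// ler_ln ?posrE// ltW.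
have lnh : (y - x) * ln (y - x) <= (y - x) * ln y.
  by rewrite ler_pM2l// ler_ln ?posrE//; lra.
have := xlnx_ge_sqrt (ltW h0).
have : (y - x) * ln y <= y - x by rewrite -[leRHS]mulr1 ler_pM2l.
by rewrite ler_norml => *; apply/andP; split; lra.
Qed.

Lemma J_unif_continuous e : 0 < e -> exists2 d, 0 < d &
  forall x y, `|x| <= 1 -> `|y| <= 1 -> `|x - y| <= d -> `|J x - J y| <= e.
Proof.
move=> e0; pose d := Num.min (e / 4) ((e / 4) ^+ 2).
have d0 : 0 < d by rewrite lt_min exprn_gt0 ?andbT// divr_gt0.
exists d => //.
move=> x y; wlog xy : x y / x <= y.
  move=> h x1 y1 xyd; have [xy|/ltW yx] := leP x y; first exact: h.
  by rewrite distrC h// distrC.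
rewrite !ler_norml => /andP[x1 x2] /andP[y1 y2] /andP[xyd _].
have hd : y - x <= d by lra.
have dle1 : d <= e / 4 by rewrite ge_min lexx.
have dle2 : Num.sqrt (y - x) <= e / 4.
  have -> : e / 4 = Num.sqrt ((e / 4) ^+ 2) by rewrite sqrtr_sqr ger0_norm//; lra.
  apply: ler_wsqrtr.
  by rewrite (le_trans hd)// ge_min lexx orbT.
have := @xlnx_modulus (1 + x) (1 + y); have := @xlnx_modulus (1 - y) (1 - x).
have -> : 1 - x - (1 - y) = y - x by lra.
have -> : 1 + y - (1 + x) = y - x by lra.
rewrite !ler_norml /J => /(_ _ _ _)/wrap[]; [lra..|move=> /andP[? ?]].
move=> /(_ _ _ _)/wrap[]; [lra..|move=> /andP[? ?]].
by apply/andP; split; lra.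
Qed.

Lemma measurable_J : measurable_fun setT (@J R).
Proof.
apply: measurable_funD; apply: measurable_funM => //.
- apply: measurable_funM; first exact: measurable_funD.
  by apply: measurableT_comp => //; exact: measurable_funD.
- apply: measurable_funM; first exact: measurable_funB.
  by apply: measurableT_comp => //; exact: measurable_funB.
Qed.

End rate_density.

(** * Lipschitz functions as integrals of their derivatives *)

Section lipschitz_density.
Variable R : realType.
Notation mu := (@lebesgue_measure R).

Lemma LS_itvoc (F : cumulative R R) (a b : R) : a <= b ->
  lebesgue_stieltjes_measure F (`]a, b]%classic : set R) = (F b - F a)%:E.
Proof.
move=> ab; rewrite /lebesgue_stieltjes_measure/= /measure_extension/=.
rewrite measurable_mu_extE/=; last exact: is_ocitv.
exact: wlength_itv_bnd.
Qed.

(** [t + phi t] and [t - phi t] are nondecreasing because [phi] is 1-Lipschitz, so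
    they define Stieltjes measures; these are dominated by the Lebesgue measure,
    being nonnegative with sum twice that measure. *)
Lemma lipschitz1_density (phi : R -> R) :
    (forall x y, `|phi x - phi y| <= `|x - y|) ->
  exists f : R -> R, mu.-integrable setT (EFin \o f) /\
    forall a b : R, 0 <= a -> a <= b -> b <= 1 ->
      (\int[mu]_(t in `]a, b]) (f t)%:E = ((b - a + (phi b - phi a)) / 2)%:E)%E.
Proof.
move=> phi_lip.
have half (c : R) : `|c| <= 1 ->
    (nondecreasing (fun t => (t + c * phi t) / 2) : Prop) /\
    right_continuous (fun t => (t + c * phi t) / 2).
  move=> c1; split.
    move=> x y xy; rewrite ler_pM2r ?invr_gt0//.
    have : c * phi x - c * phi y <= `|c * phi x - c * phi y| by exact: ler_norm.
    rewrite -mulrBr normrM => h.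
    have : `|c| * `|phi x - phi y| <= 1 * `|x - y| by rewrite ler_pM.
    have -> : `|x - y| = y - x by rewrite distrC ger0_norm ?subr_ge0.
    lra.
  apply: right_continuousW => x; apply: cvgMl; apply: cvgD; first exact: cvg_id.
  apply: cvgMr; apply/cvgrPdist_lt => e e0.
  near=> y; apply: le_lt_trans (phi_lip _ _) _.
  near: y; exact: cvgr_dist_lt.
have [F1 F2] := half 1 (eq_ind_r (fun x => x <= 1) (lexx _) (normr1 _)).
have [G1 G2] := half (- 1) (eq_ind_r (fun x => x <= 1) (lexx _) (normrN1 _)).
pose F : cumulative R R := Cumulative.Pack (Cumulative.Class (isCumulative.Build R _ R _ F1 F2)).
pose G : cumulative R R := Cumulative.Pack (Cumulative.Class (isCumulative.Build R _ R _ G1 G2)).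
(* The measures with distribution functions [(t + phi t) / 2] and
   [(t - phi t) / 2] add up to the Lebesgue measure. *)
have FG A : measurable A ->
    mu A = (lebesgue_stieltjes_measure F A + lebesgue_stieltjes_measure G A)%E.
  move=> mA; rewrite -measure_addE; apply: lebesgue_measure_unique => //.
  move=> X /ocitvP[->|[[a b]/= ab ->]]; first by rewrite !measure0.
  apply: (etrans (LS_itvoc idfun (ltW ab))); apply/esym.
  apply: (etrans (measure_addE _ _ _)).
  apply: (etrans (congr2 adde (LS_itvoc F (ltW ab)) (LS_itvoc G (ltW ab)))).
  by rewrite /F /G/=; congr EFin; lra.
have m01 : measurable (`]0, 1]%classic : set (measurableTypeR R)) by exact: measurable_itv.
have F01 : (lebesgue_stieltjes_measure F `]0%R, 1%R] < +oo)%E.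
  by rewrite LS_itvoc// ltry.
pose nu : {finite_measure set _ -> \bar R} := mfrestr m01 F01.
have numu : nu `<< mu.
  apply/null_content_dominatesP => A mA muA; rewrite /nu/= /mfrestr /mrestr.
  apply/eqP; rewrite eq_le measure_ge0 andbT.
  apply: (@le_trans _ _ (lebesgue_stieltjes_measure F A)).
    by rewrite le_measure ?inE//; exact: measurableI.
  have <- := etrans (esym (FG A mA)) muA.
  by rewrite leeDl// measure_ge0.
have [f [f0 ffin intf fE]] := radon_nikodym_sigma_finite numu.
exists (fine \o f); have ff : EFin \o (fine \o f) = f.
  by apply/funext => x/=; rewrite fineK.
split; first by rewrite ff.
move=> a b a0 ab b1.
transitivity (\int[mu]_(t in `]a, b]) f t)%E.
  by apply: eq_integral => x _; rewrite -{2}ff.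
rewrite -fE; last exact: measurable_itv.
rewrite /nu/= /mfrestr /mrestr.
have -> : `]a, b]%classic `&` `]0, 1]%classic = `]a, b]%classic :> set R.
  apply/seteqP; split => x/=; rewrite !in_itv/=; first by case.
  by move=> /andP[? ?]; split; apply/andP; split; lra.
by rewrite LS_itvoc// /F/=; congr EFin; lra.
Unshelve. all: by end_near. Qed.

End lipschitz_density.

Section integral_off_null_set.
Context d (T : measurableType d) (R : realType).
Variable mu : {measure set T -> \bar R}.
Import HBNNSimple.

(** The derivative of a Lipschitz function is only controlled off a null set, so
    [f] and [g] are arbitrary there: the integral of a nonnegative function is a
    supremum over the simple functions below it, and these may be cut to 0
    on [N]. *)
Lemma ge0_integral_eq_off_null (N : set T) (f g : T -> \bar R) :
    measurable N -> mu N = 0%E ->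
    (forall x, 0 <= f x)%E -> (forall x, 0 <= g x)%E ->
    (forall x, ~ N x -> f x = g x) ->
  (\int[mu]_x f x = \int[mu]_x g x)%E.
Proof.
move=> mN N0.
suff le f' g' : (forall x, 0 <= f' x)%E -> (forall x, 0 <= g' x)%E ->
    (forall x, ~ N x -> f' x = g' x) -> (\int[mu]_x f' x <= \int[mu]_x g' x)%E.
  move=> f0 g0 fg; apply/eqP; rewrite eq_le !le// => x Nx.
  exact/esym/fg.
move=> f0 g0 fg; rewrite !ge0_integralTE//.
apply: ge_ereal_sup => _ /= [h hf <-].
have mNC := measurableC mN.
apply: ereal_sup_ubound => /=; exists (proj_nnsfun h mNC).
  move=> x; rewrite /= mindicE; have [xN|xN] := boolP (x \in ~` N).
    by rewrite mulr1 -fg ?hf//; move: xN; rewrite inE.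
  by rewrite mulr0.
have sE (k : {nnsfun T >-> R}) : sintegral mu k = (\int[mu]_x (k x)%:E)%E.
  by rewrite integral_nnsfun// patch_setT.
rewrite !sE; apply: ae_eq_integral => //.
- by apply/measurable_EFinP; exact: measurable_funP.
- by apply/measurable_EFinP; exact: measurable_funP.
exists N; split => // x/= /not_implyP[_]; apply: contra_notP => Nx.
by rewrite mindicE mem_set// mulr1.
Qed.

End integral_off_null_set.

Section excursion_derivative.
Variable R : realType.
Notation mu := (@lebesgue_measure R).
Implicit Type phi : excursion R.

Lemma excursion_lipschitz phi (x y : R) : `|phi x - phi y| <= `|x - y|.
Proof.
have lip (s t : R) : s \in `[0, 1] -> t \in `[0, 1] -> `|phi s - phi t| <= `|s - t|.
  by move=> s01 t01; have := @excursion_lip _ phi (s, t); rewrite /= mul1r; apply.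
have i0 : (0 : R) \in `[0, 1] by rewrite in_itv/= lexx ler01.
have i1 : (1 : R) \in `[0, 1] by rewrite in_itv/= lexx ler01.
have mixed (s t : R) : s \in `[0, 1] -> t \notin `[0, 1] -> `|phi s - phi t| <= `|s - t|.
  move=> s01 t01; rewrite (@excursion_out _ phi _ t01).
  have := s01; rewrite in_itv/= => /andP[s0 s1].
  move: t01; rewrite in_itv/= negb_and -!ltNge => /orP[t0|t1].
    have := lip _ _ s01 i0; rewrite excursion_at0 => /le_trans; apply.
    by rewrite !ger0_norm; lra.
  have := lip _ _ s01 i1; rewrite excursion_at1 => /le_trans; apply.
  by rewrite !ler0_norm; lra.
have [x01|x01] := boolP (x \in `[0, 1]); have [y01|y01] := boolP (y \in `[0, 1]).
- exact: lip.
- exact: mixed.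
- by rewrite distrC [leRHS]distrC mixed.
- by rewrite !excursion_out// subrr normr0.
Qed.

Lemma lipschitz1_derive_le1 (f : R -> R) (x : R) :
  (forall x y, `|f x - f y| <= `|x - y|) -> derivable f x 1 -> `|derive1 f x| <= 1.
Proof.
move=> lip dfx; rewrite derive1E.
have le1 : \forall h \near 0^', `|h^-1 *: (f (h *: 1 + x) - f x)| <= 1.
  near=> h; have h0 : h != 0 by near: h; exact: nbhs_dnbhs_neq.
  rewrite normrZ normfV mulrC ler_pdivrMr ?normr_gt0// mul1r.
  by rewrite (le_trans (lip _ _))// addrK scaler1.
have : `|h^-1 *: (f (h *: 1 + x) - f x)| @[h --> 0^'] --> `|'D_1 f x|.
  exact: cvg_norm.
by move=> cv; exact: cvgr_to_le cv le1.
Unshelve. all: by end_near. Qed.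

(** The classical content is Lebesgue's theorem: a Lipschitz function is
    almost everywhere differentiable and is the integral of its derivative. *)
Lemma excursion_ae_derivative phi : exists g : R -> R,
  [/\ measurable_fun setT g, forall x, `|g x| <= 1,
      forall a b : R, 0 <= a -> a <= b -> b <= 1 ->
        (\int[mu]_(t in `]a, b]) (g t)%:E = (phi b - phi a)%:E)%E &
      exists N : set R, [/\ measurable N, mu N = 0%E &
        forall x, 0 < x -> x < 1 -> ~ N x ->
          derivable phi x 1 /\ derive1 phi x = g x]].
Proof.
have [f [intf fE]] := lipschitz1_density (@excursion_lipschitz phi).
have mf : measurable_fun setT f by apply/measurable_EFinP; exact: measurable_int intf.
pose g x := Num.max (- 1) (Num.min 1 (2 * f x - 1)).
have mg : measurable_fun setT g.
  apply: measurable_maxr => //; apply: measurable_minr => //.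
  by apply: measurable_funB => //; exact: measurable_funM.
have intitv (i : interval R) : mu.-integrable [set` i] (EFin \o f).
  exact: integrableS intf.
have := @FTC1 R f (BRight 0) (fun y => intitv _)
  (open_integrable_locally openT intf).
move=> [N [mN N0 subN]].
have diff x : 0 < x -> x < 1 -> ~ N x -> derivable phi x 1 /\ derive1 phi x = 2 * f x - 1.
  move=> x0 x1 Nx; have := contrapT (fun h => Nx (subN x h)).
  move=> /(_ _)/wrap[]; first exact: x0.
  set F := (F in derivable F x 1) => -[dF F'].
  have eqF : \forall y \near x, phi y = 2 * F y - y.
    near=> y; have y0 : 0 < y by near: y; exact: lt_nbhsr.
    have y1 : y < 1 by near: y; exact: lt_nbhsl.
    have := fE 0 y (lexx 0) (ltW y0) (ltW y1); rewrite /F /Rintegral excursion_at0.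
    by move=> -> /=; lra.
  have is2F : is_derive x 1 (fun y => 2 * F y - y) (2 * f x - 1).
    have is1F : is_derive x 1 F (f x) by split => //; rewrite -derive1E.
    have := is_deriveB (is_deriveZ 2 is1F) (is_derive_id x 1).
    by [].
  have phiF : \forall y \near x, 2 * F y - y = phi y.
    by near=> z; apply/esym; near: z.
  have [dphi Dphi] := @near_eq_is_derive _ R^o R^o _ _ _ _ _ phiF is2F.
  by rewrite derive1E.
have gE x : 0 < x -> x < 1 -> ~ N x -> g x = 2 * f x - 1.
  move=> x0 x1 Nx; have [dphi phi'] := diff x x0 x1 Nx.
  have := lipschitz1_derive_le1 (@excursion_lipschitz phi) dphi.
  rewrite phi' ler_norml => /andP[? ?].
  by rewrite /g min_r// max_r.
exists g; split => //.
- move=> x; rewrite /g ler_norml; apply/andP; split; first by rewrite le_max lexx.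
  by rewrite ge_max ge_min lexx/= andbT; lra.
- move=> a b a0 ab b1.
  transitivity (\int[mu]_(t in `]a, b]) (2 * f t - 1)%:E)%E.
    apply: ae_eq_integral => //.
    + by apply/measurable_EFinP; exact: measurable_funTS.
    + apply/measurable_EFinP; apply: measurable_funTS.
      by apply: measurable_funB => //; exact: measurable_funM.
    exists (N `|` [set 1]); split => //.
    + exact: measurableU.
    + apply/eqP; rewrite eq_le measure_ge0 andbT.
      apply: le_trans (measureU2 _ _ _) _ => //.
      rewrite -[leRHS]adde0; apply: leeD; rewrite le_eqVlt; apply/orP; left.
        exact/eqP/N0.
      exact/eqP/lebesgue_measure_set1.
    move=> x /= /not_implyP[]; rewrite in_itv/= => /andP[ax xb] neq.
    have [->|xn1] := eqVneq x 1; [by right|left].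
    apply: contrapT => Nx; apply: neq; rewrite gE//; first lra.
    by rewrite lt_neqAle xn1/=; lra.
  transitivity (2%:E * (\int[mu]_(t in `]a, b]) (f t)%:E) - mu `]a, b])%E.
    under eq_integral do rewrite EFinB EFinM.
    rewrite integralB//=; last first.
    + apply: measurable_bounded_integrable => //.
        apply: (@eq_ind_r _ _ (fun z => (z < +oo)%E) _ _ (lebesgue_measure_itv `]a, b])).
        by rewrite /=; case: ifP => _; rewrite ltry.
      by exists 1; split => // M M1 x _ /=; rewrite normr1 ltW.
    + by apply: integrableZl => //; exact: intitv.
    by rewrite integralZl// ?integral_cst ?mul1e//; exact: intitv.
  rewrite fE// lebesgue_measure_itv/= lte_fin; case: ltP => ab'; congr EFin; [lra|].
  have -> : a = b by lra.
  lra.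
- exists N; split => // x x0 x1 Nx; rewrite gE//; exact: diff.
Unshelve. all: by end_near. Qed.
End excursion_derivative.

(** * Discretized rates *)

Section discrete_rate.
Variable R : realType.
Notation mu := (@lebesgue_measure R).
Implicit Type phi : excursion R.

Definition discrete_rate (N : nat) (f : R -> R) : R :=
  2 / N%:R *
    \sum_(i < N) J (N%:R * (f (i.+1%:R / N%:R) - f (i%:R / N%:R))).

Lemma mu_itvoc (a b : R) : a <= b -> mu `]a, b]%classic = (b - a)%:E.
Proof.
move=> ab; apply: (etrans (lebesgue_measure_itv `]a, b])); rewrite /= lte_fin.
by case: ltP => // ba; congr EFin; lra.
Qed.

Lemma integral_cst_itvoc (c a b : R) : a <= b ->
  (\int[mu]_(t in `]a, b]) c%:E)%E = (c * (b - a))%:E.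
Proof.
move=> ab; rewrite integral_cst//.
exact: (congr1 (mule c%:E) (mu_itvoc ab)).
Qed.

Lemma H231_density phi (g : R -> R) (N : set R) :
    measurable N -> mu N = 0%E ->
    (forall x, 0 < x -> x < 1 -> ~ N x -> derive1 phi x = g x) ->
  H231 phi = (2%:E * \int[mu]_(t in `]0%R, 1%R]) (J (g t))%:E)%E.
Proof.
move=> mN N0 phiE; rewrite /H231; congr (_ * _)%E.
rewrite integral_mkcond [RHS]integral_mkcond.
apply: (@ge0_integral_eq_off_null _ (measurableTypeR R) R mu (N `|` ([set 0] `|` [set 1]))).
- by do 2?apply: measurableU.
- apply/eqP; rewrite eq_le measure_ge0 andbT.
  apply: le_trans (measureU2 _ _ _) _ => //; first exact: measurableU.
  rewrite -[leRHS]adde0; apply: leeD.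
    by rewrite le_eqVlt; apply/orP; left; exact/eqP/N0.
  apply: le_trans (measureU2 _ _ _) _ => //.
  rewrite -[leRHS]adde0; apply: leeD; rewrite le_eqVlt; apply/orP; left;
    exact/eqP/lebesgue_measure_set1.
- by move=> x; rewrite patchE; case: ifP => // _; rewrite lee_fin J_ge0.
- by move=> x; rewrite patchE; case: ifP => // _; rewrite lee_fin J_ge0.
move=> x /not_orP[Nx /not_orP[x0 x1]].
have e0 : x != 0 by apply/eqP.
have e1 : x != 1 by apply/eqP.
rewrite !patchE; have [xi|xi] := boolP (x \in `]0, 1]%classic).
  move: (xi); rewrite inE/= in_itv/= => /andP[x0' x1'].
  rewrite mem_set/=; last by rewrite in_itv/= x1' ltW.
  by rewrite phiE// lt_neqAle e1.
rewrite memNset//= in_itv/= => /andP[x0' x1']; move/negP: xi; apply.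
by rewrite inE/= in_itv/= x1' lt_neqAle eq_sym e0 x0'.
Qed.

(** Jensen's inequality on one interval.  At an extremal average slope [J] has
    no tangent, hence the detour through the slopes [r * s] with [r < 1]. *)
Lemma jensen_J (g : R -> R) (a b d : R) :
    measurable_fun setT g -> (forall x, `|g x| <= 1) -> a < b ->
    (\int[mu]_(t in `]a, b]) (g t)%:E = d%:E)%E ->
  (((b - a) * J (d / (b - a)))%:E <= \int[mu]_(t in `]a, b]) (J (g t))%:E)%E.
Proof.
move=> mg g1 ab gd; have ba0 : 0 < b - a by lra.
have fin_ab : (mu `]a, b] < +oo)%E by rewrite mu_itvoc ?ltW// ltry.
have intg : mu.-integrable `]a, b] (EFin \o g).
  apply: measurable_bounded_integrable => //; first exact: measurable_funTS.
  by exists 1; split => // M M1 x _; rewrite /= (le_trans (g1 x))// ltW.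
set s := d / (b - a).
have s1 : `|s| <= 1.
  rewrite /s normrM normfV (gtr0_norm ba0) ler_pdivrMr// mul1r -lee_fin.
  have -> : (`|d|%:E = `| \int[mu]_(t in `]a, b]) (g t)%:E |)%E by rewrite gd.
  apply: le_trans (le_abse_integral _ _ _) _ => //.
    by apply/measurable_EFinP; exact: measurable_funTS.
  rewrite -(mu_itvoc (ltW ab)) -[leRHS]mul1e -integral_cst//.
  apply: ge0_le_integral => //.
  - by apply/measurable_EFinP; apply: measurableT_comp => //; exact: measurable_funTS.
  - by move=> x _; rewrite lee_fin.
(* The tangent of [J] at [r * s], integrated over the interval. *)
have step r : 0 <= r -> r < 1 ->
    (((b - a) * J (r * s))%:E <= \int[mu]_(t in `]a, b]) (J (g t))%:E)%E.
  move=> r0 r1; have rs1 : `|r * s| < 1.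
    by rewrite normrM (ger0_norm r0) (le_lt_trans _ r1)// ler_piMr.
  pose l := 2^-1 * (ln (1 + r * s) - ln (1 - r * s)).
  pose c := J (r * s) - l * (r * s).
  have -> : (b - a) * J (r * s) = c * (b - a) + l * d - (b - a) * (l * s * (1 - r)).
    by rewrite /c /s; field; rewrite gt_eqF.
  have ls : 0 <= l * s.
    move: rs1; rewrite ltr_norml => /andP[? ?].
    have [s0|s0] := leP 0 s.
      have rs0 : 0 <= r * s by rewrite mulr_ge0.
      by rewrite mulr_ge0// /l mulr_ge0// subr_ge0 ler_ln ?posrE; lra.
    have rs0 : r * s <= 0 by rewrite mulr_ge0_le0// ltW.
    apply: mulr_le0; last exact: ltW.
    by rewrite /l; apply: mulr_ge0_le0 => //; rewrite subr_le0 ler_ln ?posrE; lra.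
  apply: (@le_trans _ _ (c * (b - a) + l * d)%:E).
    by rewrite lee_fin gerBl mulr_ge0 ?(ltW ba0)// mulr_ge0//; lra.
  have intl : mu.-integrable `]a, b] (fun t => l%:E * (g t)%:E)%E.
    exact: integrableZl.
  have intc : mu.-integrable `]a, b] (cst c%:E).
    apply: measurable_bounded_integrable => //.
    by exists `|c|; split => // M M1 x _ /=; rewrite ltW.
  have -> : ((c * (b - a) + l * d)%:E =
      \int[mu]_(t in `]a, b]) (c%:E + l%:E * (g t)%:E))%E.
    rewrite integralD// integralZl// integral_cst_itvoc ?ltW//.
    by rewrite gd.
  apply: le_integral => //.
  - exact: integrableD.
  - apply: measurable_bounded_integrable => //.
      by apply: measurable_funTS; apply: measurableT_comp => //; exact: measurable_J.
    exists (ln 2); split; first exact: num_real.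
    move=> M M1 x _ /=.
    by rewrite ger0_norm ?J_ge0// (le_trans (J_le_ln2 (g1 x)))// ltW.
  move=> x _; rewrite -EFinM -EFinD lee_fin.
  have := J_tangent rs1 (g1 x); rewrite -/l /c; lra.
apply/lee_addgt0Pr => e e0.
have [dl dl0 Jd] := J_unif_continuous (divr_gt0 e0 ba0).
pose r := 1 - Num.min 1 dl.
have r0 : 0 <= r by rewrite /r subr_ge0 ge_min lexx.
have r1 : r < 1 by rewrite /r ltrBlDr ltrDl lt_min ltr01.
apply: (@le_trans _ _ (((b - a) * J (r * s))%:E + e%:E)%E); last exact/leeD2r/step.
rewrite -EFinD lee_fin.
have : `|J s - J (r * s)| <= e / (b - a).
  apply: Jd => //.
    by rewrite normrM (ger0_norm r0) mulr_ile1// ltW.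
  have -> : s - r * s = (1 - r) * s by ring.
  rewrite normrM ger0_norm ?subr_ge0 ?(ltW r1)//.
  rewrite (@le_trans _ _ (1 - r))//; first by rewrite ler_piMr// subr_ge0 ltW.
  by rewrite /r opprB addrCA subrr addr0 ge_min lexx orbT.
rewrite ler_pdivlMr// mulrC; have := ler_norm (J s - J (r * s)); nra.
Qed.

End discrete_rate.

(** * The rate is the supremum of the discretized rates *)

Section limn_bounds.
Variable R : realType.

Lemma near_limn_esup_le (u : (\bar R)^nat) (M : \bar R) :
  (\forall n \near \oo, u n <= M)%E -> (limn_esup u <= M)%E.
Proof.
move=> uM; rewrite /limn_esup /limf_esup.
apply: (@le_trans _ _ (ereal_sup (u @` [set n | (u n <= M)%E]))).
  by apply: ereal_inf_lbound; exists [set n | (u n <= M)%E].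
by apply: ge_ereal_sup => _ [n /= nM <-].
Qed.

Lemma near_limn_einf_ge (u : (\bar R)^nat) (M : \bar R) :
  (\forall n \near \oo, M <= u n)%E -> (M <= limn_einf u)%E.
Proof.
move=> uM; rewrite /limn_einf leeNr; apply: near_limn_esup_le.
by apply: filterS uM => n /=; rewrite leeN2.
Qed.

End limn_bounds.

Section discrete_rate_limit.
Variable R : realType.
Notation mu := (@lebesgue_measure R).
Implicit Type phi : excursion R.

Let block (N i : nat) : set R := `]i%:R / N%:R, i.+1%:R / N%:R]%classic.

Lemma block_lt N i : (0 < N)%N -> (i%:R / N%:R : R) < i.+1%:R / N%:R.
Proof. by move=> N0; rewrite ltr_pM2r ?ltr_nat// invr_gt0 ltr0n. Qed.

Lemma block_len N i : (0 < N)%N -> (i.+1%:R / N%:R : R) - i%:R / N%:R = N%:R^-1.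
Proof. by move=> N0; rewrite -mulrBl -natrB// subSnn mul1r. Qed.

(** Jensen's inequality on each block. *)
Lemma discrete_rate_le_H231 N phi : (0 < N)%N ->
  ((discrete_rate N phi)%:E <= H231 phi)%E.
Proof.
move=> N0; have [g [mg g1 gE [A [mA A0 phig]]]] := excursion_ae_derivative phi.
have phi'E x : 0 < x -> x < 1 -> ~ A x -> derive1 phi x = g x.
  by move=> x0 x1 Ax; have [] := phig x x0 x1 Ax.
rewrite (H231_density mA A0 phi'E) /discrete_rate -mulrA EFinM.
apply: lee_wpmul2l => //.
have Nr : 0 < N%:R :> R by rewrite ltr0n.
have mJg : measurable_fun setT (fun t => (J (g t))%:E).
  by apply/measurable_EFinP; apply: measurableT_comp => //; exact: measurable_J.
have part k : (k <= N)%N ->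
    ((N%:R^-1 * \sum_(i < k) J (N%:R * (phi (i.+1%:R / N%:R) - phi (i%:R / N%:R))))%:E
      <= \int[mu]_(t in `]0%R, (k%:R / N%:R)%R]) (J (g t))%:E)%E.
  elim: k => [_|k IH kN].
    by rewrite big_ord0 mulr0 integral_ge0// => x _; rewrite lee_fin J_ge0.
  rewrite big_ord_recr/= mulrDr EFinD.
  have k0 : 0 <= k%:R / N%:R :> R by rewrite divr_ge0.
  have kk1 := block_lt k N0.
  have -> : `]0, (k.+1%:R / N%:R)]%classic =
      `]0, (k%:R / N%:R)] `|` `](k%:R / N%:R), (k.+1%:R / N%:R)] :> set R.
    apply/seteqP; split => x/=; rewrite !in_itv/=.
      by move=> /andP[x0 xk]; rewrite x0 xk/= andbT; have [|] := leP x (k%:R / N%:R);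
        [left|right].
    by move=> [|] /andP[? ?]; apply/andP; split; lra.
  rewrite ge0_integral_setU//=; last 3 first.
  - by apply: measurable_funTS.
  - by move=> x _; rewrite lee_fin J_ge0.
  - apply/disj_setPS => x/=; rewrite !in_itv/= => -[/andP[_ xk] /andP[kx _]].
    by have := lt_le_trans kx xk; rewrite ltxx.
  apply: leeD; first by apply: IH; rewrite ltnW.
  have := @jensen_J _ g _ _ (phi (k.+1%:R / N%:R) - phi (k%:R / N%:R)) mg g1 kk1.
  rewrite block_len// invrK [X in J X]mulrC; apply; apply: gE => //; first exact: ltW.
  by rewrite ler_pdivrMr// mul1r ler_nat.
have := part N (leqnn N); rewrite divff ?gt_eqF//; exact.
Qed.

(** The block need not start at [x]: both of its ends are compared with the tangent
    line at [x], and their distances to [x] add up to the length of the block. *)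
Lemma derivable_block_slope (f : R -> R) (x e : R) : derivable f x 1 -> 0 < e ->
  \forall N \near \oo, forall i : nat, block N i x ->
    `|N%:R * (f (i.+1%:R / N%:R) - f (i%:R / N%:R)) - derive1 f x| <= e.
Proof.
move=> dfx e0; rewrite derive1E.
have : h^-1 *: (f (h *: 1 + x) - f x) @[h --> 0^'] --> 'D_1 f x by exact: dfx.
move=> /cvgrPdist_le /(_ e e0) [d /= d0 dP].
have slope y : `|y - x| < d -> `|f y - f x - (y - x) * 'D_1 f x| <= e * `|y - x|.
  move=> yxd; have [->|yx] := eqVneq y x.
    by rewrite !subrr mul0r subr0 normr0 mulr0.
  have yx0 : y - x != 0 by rewrite subr_eq0.
  have /= := dP (y - x); rewrite sub0r normrN => /(_ yxd yx0).
  rewrite scaler1 subrK.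
  have -> : f y - f x - (y - x) * 'D_1 f x =
      - ((y - x) * ('D_1 f x - (y - x)^-1 *: (f y - f x))).
    by rewrite /GRing.scale/=; field.
  by rewrite normrN normrM mulrC ler_pM2r ?normr_gt0.
near=> N => i; rewrite /block/= in_itv/= => /andP[ix xi].
have N0 : (0 < N)%N by near: N; exact: nbhs_infty_gt.
have Nr : 0 < N%:R :> R by rewrite ltr0n.
have Nd : N%:R^-1 < d.
  by rewrite invf_plt ?posrE//; near: N; exact: nbhs_infty_gtr.
have len := block_len i N0.
set a := i%:R / N%:R in ix len *; set b := i.+1%:R / N%:R in xi len *.
have hb : `|b - x| = b - x by rewrite ger0_norm// subr_ge0.
have ha : `|a - x| = x - a by rewrite distrC ger0_norm// subr_ge0 ltW.
have := slope b; rewrite hb => /(_ _)/wrap[]; first lra.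
have := slope a; rewrite ha => /(_ _)/wrap[]; first lra.
move=> sa sb.
have -> : N%:R * (f b - f a) - 'D_1 f x =
    N%:R * ((f b - f x - (b - x) * 'D_1 f x) - (f a - f x - (a - x) * 'D_1 f x)).
  have -> : (f b - f x - (b - x) * 'D_1 f x) - (f a - f x - (a - x) * 'D_1 f x) =
     f b - f a - (b - a) * 'D_1 f x by ring.
  by rewrite len; field; rewrite gt_eqF.
rewrite normrM gtr0_norm// -ler_pdivlMl//.
apply: le_trans (ler_normB _ _) _; rewrite -len; lra.
Unshelve. all: by end_near. Qed.

(** Fatou's lemma for the step functions [F n], whose integral is half a
    discretized rate and which converge to [J] of the derivative at every point
    of differentiability. *)
Lemma H231_gt_discrete_rate phi (a : R) : (a%:E < H231 phi)%E ->
  exists2 N, (0 < N)%N & a < discrete_rate N phi.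
Proof.
move=> aH; apply: contrapT => noN; move: aH; apply/negP; rewrite -leNgt.
have Hle N : (0 < N)%N -> discrete_rate N phi <= a.
  by move=> N0; rewrite leNgt; apply/negP => aN; apply: noN; exists N.
have [g [mg g1 gE [A [mA A0 phig]]]] := excursion_ae_derivative phi.
have phi'E x : 0 < x -> x < 1 -> ~ A x -> derive1 phi x = g x.
  by move=> x0 x1 Ax; have [] := phig x x0 x1 Ax.
pose c N i := J (N%:R * (phi (i.+1%:R / N%:R) - phi (i%:R / N%:R))).
pose F n x := (\sum_(i < n.+1) (c n.+1 i * \1_(block n.+1 i) x)%:E)%E.
have mB n i : measurable (block n i) by exact: measurable_itv.
have mF n : measurable_fun setT (F n).
  apply: emeasurable_sum => i; apply/measurable_EFinP; apply: measurable_funM => //.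
have F0 n x : (0 <= F n x)%E.
  by apply: sume_ge0 => i _; rewrite lee_fin mulr_ge0// J_ge0.
have FE n i x : (i < n.+1)%N -> block n.+1 i x -> F n x = (c n.+1 i)%:E.
  move=> iN xi; rewrite /F (bigD1 (Ordinal iN))//= indicE mem_set// mulr1.
  rewrite big1 ?adde0// => j ji; rewrite indicE memNset ?mulr0// => xj.
  move/negP: ji; apply; apply/eqP/val_inj => /=.
  move: xi xj; rewrite /block/= !in_itv/= => /andP[h1 h2] /andP[h3 h4].
  have Nr : 0 < n.+1%:R^-1 :> R by rewrite invr_gt0.
  have := lt_le_trans h1 h4; have := lt_le_trans h3 h2.
  by rewrite !ltr_pM2r// !ltr_nat; lia.
have intF n : (\int[mu]_(x in `]0%R, 1%R]) F n x = (discrete_rate n.+1 phi / 2)%:E)%E.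
  rewrite /F ge0_integral_sum//; last 2 first.
  - move=> i; apply/measurable_EFinP; apply: measurable_funTS.
    by apply: measurable_funM => //; apply: measurable_indic; exact: mB.
  - by move=> i x _; rewrite lee_fin mulr_ge0// J_ge0.
  have -> : discrete_rate n.+1 phi / 2 = \sum_(i < n.+1) c n.+1 i * n.+1%:R^-1.
    by rewrite /discrete_rate -mulr_suml -/(c _ _); field; rewrite addrC natr1 pnatr_eq0.
  rewrite -sumEFin; apply: eq_bigr => i _.
  under eq_integral do rewrite EFinM.
  rewrite ge0_integralZl//=; last 2 first.
  - by apply/measurable_EFinP; apply: measurable_indic; exact: mB.
  - by rewrite lee_fin J_ge0.
  rewrite integral_indic; last exact: mB.
  rewrite EFinM; congr (_ * _)%E.
  have -> : block n.+1 i `&` `]0, 1] = block n.+1 i.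
    apply/seteqP; split => x; first by case.
    move=> xB; split => //; move: xB; rewrite /block/= !in_itv/= => /andP[ix xi].
    rewrite (le_lt_trans _ ix) ?divr_ge0//= (le_trans xi)//.
    by rewrite ler_pdivrMr// mul1r ler_nat.
  by apply: (etrans (mu_itvoc (ltW (block_lt i (ltn0Sn n))))); rewrite block_len.
  exact: measurable_itv.
have limF x : 0 < x -> x < 1 -> ~ A x -> limn_einf (F^~ x) = (J (g x))%:E.
  move=> x0 x1 Ax; apply: (cvg_limn_einf_sup _).1.
  apply/fine_cvgP; split.
    by apply: nearW => m; rewrite /F sumEFin.
  apply/cvgrPdist_le => e e0; have [d d0 Jd] := J_unif_continuous e0.
  have [dphi phix] := phig x x0 x1 Ax.
  have := derivable_block_slope dphi d0; rewrite phix => slope.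
  have slopeS : \forall n \near \oo, forall i : nat, block n.+1 i x ->
    `|n.+1%:R * (phi (i.+1%:R / n.+1%:R) - phi (i%:R / n.+1%:R)) - g x| <= d.
    by move: slope => [m _ mP]; exists m => // k /= mk; apply: mP => /=; exact: leqW.
  near=> p.
  have [k kN xk] : exists2 k, (k < p.+1)%N & block p.+1 k x.
    have nx0 : 0 < p.+1%:R * x by rewrite mulr_gt0.
    have ex : exists m, p.+1%:R * x <= m%:R.
      by exists (Num.trunc (p.+1%:R * x)).+1; rewrite ltW// Num.Theory.truncnS_gt.
    case: (ex_minnP ex) => -[|m]; first by rewrite leNgt nx0.
    move=> xm min_m; exists m.
      by apply: (min_m p.+1); rewrite ler_piMr// ltW.
    rewrite /block/= in_itv/= ltr_pdivrMr// ler_pdivlMr// ![x * _]mulrC xm andbT.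
    by rewrite ltNge; apply/negP => /min_m; rewrite ltnn.
  rewrite /= (FE _ _ _ kN xk)/=; apply: Jd.
  - exact: g1.
  - rewrite normrM gtr0_norm// -ler_pdivlMl// mulr1.
    by rewrite (le_trans (excursion_lipschitz _ _ _))// block_len// gtr0_norm.
  - by rewrite distrC; move: k xk {kN}; near: p.
rewrite (H231_density mA A0 phi'E).
have -> : (\int[mu]_(t in `]0%R, 1%R]) (J (g t))%:E =
    \int[mu]_(t in `]0%R, 1%R]) limn_einf (F^~ t))%E.
  rewrite integral_mkcond [RHS]integral_mkcond.
  have Fx0 x : (0 <= limn_einf (F^~ x))%E.
    by apply: near_limn_einf_ge; apply: nearW => n; exact: F0.
  have m1 : measurable [set (1 : R)] by exact: measurable_set1.
  apply: (@ge0_integral_eq_off_null _ (measurableTypeR R) R mu (A `|` [set 1])).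
  - exact: measurableU.
  - apply/eqP; rewrite eq_le measure_ge0 andbT.
    apply: le_trans (measureU2 _ _ _) _ => //.
    rewrite -[leRHS]adde0; apply: leeD; rewrite le_eqVlt; apply/orP; left.
      exact/eqP/A0.
    exact/eqP/lebesgue_measure_set1.
  - by move=> x; rewrite patchE; case: ifP => // _; rewrite lee_fin J_ge0.
  - by move=> x; rewrite patchE; case: ifP => // _.
  move=> x /not_orP[Ax x1]; rewrite !patchE; case: ifPn => //.
  rewrite inE/= in_itv/= => /andP[x0 x1']; rewrite limF// lt_neqAle x1' andbT.
  by apply/eqP => x1''; apply: x1.
apply: (@le_trans _ _ (2%:E * (a / 2)%:E)%E); last by rewrite -EFinM mulrC divfK.
apply: lee_wpmul2l => //.
apply: le_trans (fatou _ _ _ _) _ => //.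
- by move=> n; apply: measurable_funTS; exact: mF.
apply: le_trans (limn_einf_sup _) _; apply: near_limn_esup_le.
by apply: nearW => n; rewrite intF lee_fin ler_pM2r// Hle.
Unshelve. all: by end_near. Qed.

End discrete_rate_limit.

(** * The space of excursions *)

Section excursion_space.
Variable R : realType.
Implicit Types phi psi : excursion R.

Lemma excursion_sup_dist_le phi psi (M : R) :
  (forall t, 0 <= t -> t <= 1 -> `|phi t - psi t| <= M) -> sup_dist phi psi <= M.
Proof.
move=> H; apply: ge_sup.
  by exists `|phi 0 - psi 0|; exists 0; rewrite //= in_itv/= lexx ler01.
by move=> _ [t /= + <-]; rewrite in_itv/= => /andP[t0 t1]; exact: H.
Qed.

Lemma excursion_le_sup_dist phi psi t : `|phi t - psi t| <= sup_dist phi psi.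
Proof.
have hs : has_sup [set `|phi t - psi t| | t in `[0, 1]].
  split; first by exists `|phi 0 - psi 0|; exists 0; rewrite //= in_itv/= lexx ler01.
  exists 1 => _ [s _ <-]; rewrite ler_norml.
  have /andP[? ?] := excursion_le1 phi s; have /andP[? ?] := excursion_le1 psi s.
  by apply/andP; split; lra.
have le01 s : s \in `[0, 1] -> `|phi s - psi s| <= sup_dist phi psi.
  by move=> s01; apply: sup_upper_bound => //; exists s.
have [t01|t01] := boolP (t \in `[0, 1]); first exact: le01.
rewrite (@excursion_out _ phi _ t01) (@excursion_out _ psi _ t01) subrr normr0.
by rewrite (le_trans _ (le01 0 _)) ?in_itv/= ?lexx ?ler01.
Qed.

Lemma excursion_ballE phi (e : R) : ball phi e = [set psi | sup_dist phi psi < e].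
Proof. by []. Qed.

(** Along an ultrafilter all the values [phi t] converge, because they lie in
    [0, 1]; the pointwise limit is again an excursion, and by equicontinuity the
    convergence is uniform. *)
Lemma excursion_compact : compact [set: excursion R].
Proof.
rewrite compact_ultra => F UF _.
have PF : ProperFilter F by exact: ultra_proper.
pose ev (t : R) (phi : excursion R) : R := phi t.
have lim_ex (t : R) : exists l : R, ev t @ F --> l.
  have F01 : F (ev t @^-1` `[0, 1]%classic).
    apply: filterS (@filterT _ F _) => phi _.
    by rewrite /ev /= in_itv/=; exact: excursion_le1.
  have [l [_ cl]] := @segment_compact R 0 1 (ev t @ F) _ F01; exists l => V Vl.
  have [//|FnV] := in_ultra_setVsetC (ev t @^-1` V) UF.
  have [y [/= nVy Vy]] := cl (~` V) V FnV Vl.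
  by [].
have /choice[l lE] := lim_ex.
have l_ge0 t : 0 <= l t.
  apply: (cvgr_to_ge (lE t)); apply: nearW => phi.
  by rewrite /ev; have /andP[] := excursion_le1 phi t.
have l_le0 t : (forall phi, phi t = 0) -> l t = 0.
  move=> phit; apply/eqP; rewrite eq_le l_ge0 andbT.
  by apply: (cvgr_to_le (lE t)); apply: nearW => phi; rewrite /ev phit.
have l_lip s t : `|l s - l t| <= `|s - t|.
  have cv : (fun phi => `|ev s phi - ev t phi|) @ F --> `|l s - l t|.
    by apply: cvg_norm; exact: cvgB.
  by apply: (cvgr_to_le cv); apply: nearW => phi; exact: excursion_lipschitz.
have lip1 : 1.-lipschitz_`[0, 1] l.
  by move=> [s t] _ /=; rewrite mul1r.
pose lim := Excursion lip1 (fun t _ => l_ge0 t)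
  (l_le0 _ (@excursion_at0 R)) (l_le0 _ (@excursion_at1 R))
  (fun t t01 => l_le0 t (fun phi => @excursion_out R phi t t01)).
exists lim; split => // V; rewrite -nbhs_ballE => -[e /= e0 eV].
have e3 : 0 < e / 4 by rewrite divr_gt0.
(* Pointwise convergence on a finite grid of mesh at most e / 4 is enough. *)
pose N := (Num.trunc (4 / e)).+1.
have Ne : N%:R^-1 < e / 4.
  by rewrite -[ltRHS]invf_div ltf_pV2 ?posrE ?divr_gt0// Num.Theory.truncnS_gt.
have grid : F [set phi | forall i : 'I_N.+1,
    `|l (i%:R / N%:R) - ev (i%:R / N%:R) phi| < e / 4].
  apply: (@filter_forall _ _ (fun (i : 'I_N.+1) phi =>
    `|l (i%:R / N%:R) - ev (i%:R / N%:R) phi| < e / 4)) => i.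
  by have /cvgrPdist_lt/(_ _ e3) := lE (i%:R / N%:R).
apply: filterS grid => phi phiE; apply: eV; rewrite excursion_ballE/=.
apply: (@le_lt_trans _ _ (3 * (e / 4))); last lra.
apply: excursion_sup_dist_le => t t0 t1.
pose i := Num.trunc (t * N%:R).
have tN0 : 0 <= t * N%:R by rewrite mulr_ge0.
have iN : (i <= N)%N.
  by rewrite /i -ltnS Num.Theory.truncn_lt_nat// (@le_lt_trans _ _ N%:R) ?ltr_nat// ler_piMl.
have /andP[it ti] := Num.Theory.truncn_itv tN0.
have ti' : `|t - i%:R / N%:R| <= e / 4.
  rewrite ger0_norm; last by rewrite subr_ge0 ler_pdivrMr.
  rewrite (le_trans _ (ltW Ne))// lerBlDl -[X in _ <= _ + X]mul1r -mulrDl.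
  by rewrite natr1 ler_pdivlMr// ltW.
have /ltW/= pi := phiE (Ordinal (iN : (i < N.+1)%N)); rewrite /ev in pi.
have pt := excursion_lipschitz phi (i%:R / N%:R) t.
have lt := l_lip t (i%:R / N%:R).
have -> : lim t - phi t = (l t - l (i%:R / N%:R)) +
  (l (i%:R / N%:R) - phi (i%:R / N%:R)) + (phi (i%:R / N%:R) - phi t) by rewrite /=; ring.
rewrite (le_trans (ler_normD _ _))//.
have := ler_normD (l t - l (i%:R / N%:R)) (l (i%:R / N%:R) - phi (i%:R / N%:R)).
rewrite distrC in pt; rewrite [`|i%:R / N%:R - t|]distrC in pt; rewrite distrC in pt; lra.
Qed.

Lemma sum_J_close n (w w' y y' : nat -> R) (d e : R) :
    (forall a b : R, `|a| <= 1 -> `|b| <= 1 -> `|a - b| <= d -> `|J a - J b| <= e) ->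
    (forall i, (i < n)%N -> [/\ 0 <= w' i, `|y i| <= 1, `|y' i| <= 1 &
       `|y i - y' i| <= d]) ->
  `|\sum_(i < n) w i * J (y i) - \sum_(i < n) w' i * J (y' i)| <=
  \sum_(i < n) (w' i * e + `|w i - w' i|).
Proof.
move=> Jd H; rewrite -sumrB; apply: le_trans (ler_norm_sum _ _ _) _.
apply: ler_sum => i _; have [w0 y1 y1' yd] := H i (ltn_ord i).
have -> : w i * J (y i) - w' i * J (y' i) =
  w' i * (J (y i) - J (y' i)) + (w i - w' i) * J (y i) by ring.
apply: le_trans (ler_normD _ _) _; rewrite !normrM (ger0_norm w0).
apply: lerD; first by rewrite ler_wpM2l// Jd.
rewrite ler_piMr// ger0_norm ?J_ge0//.
exact: le_trans (J_le_ln2 y1) (ln2_le1 _).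
Qed.

Lemma grid_slope_le1 N phi (i : nat) : (0 < N)%N ->
  `|N%:R * (phi (i.+1%:R / N%:R) - phi (i%:R / N%:R))| <= 1.
Proof.
move=> N0; rewrite normrM ger0_norm// -ler_pdivlMl ?ltr0n// mulr1.
by rewrite (le_trans (excursion_lipschitz _ _ _))// block_len// ger0_norm// invr_ge0.
Qed.

Lemma discrete_rate_unif_continuous N (e : R) : (0 < N)%N -> 0 < e ->
  exists2 d, 0 < d & forall phi psi, sup_dist phi psi < d ->
    `|discrete_rate N phi - discrete_rate N psi| <= e.
Proof.
move=> N0 e0; have Nr : 0 < N%:R :> R by rewrite ltr0n.
have e2 : 0 < e / 2 by rewrite divr_gt0.
have [d d0 Jd] := J_unif_continuous e2.
exists (d / (2 * N%:R)); first by rewrite divr_gt0// mulr_gt0.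
move=> phi psi pp; rewrite /discrete_rate !mulr_sumr.
have := @sum_J_close N (fun=> 2 / N%:R) (fun=> 2 / N%:R)
  (fun i => N%:R * (phi (i.+1%:R / N%:R) - phi (i%:R / N%:R)))
  (fun i => N%:R * (psi (i.+1%:R / N%:R) - psi (i%:R / N%:R))) d (e / 2) Jd.
move=> /(_ _)/wrap[].
  move=> i _; split; [by rewrite divr_ge0|exact: grid_slope_le1|exact: grid_slope_le1|].
  have h1 := excursion_le_sup_dist phi psi (i.+1%:R / N%:R).
  have h2 := excursion_le_sup_dist phi psi (i%:R / N%:R).
  rewrite -mulrBr normrM gtr0_norm// -ler_pdivlMl//.
  have -> : N%:R^-1 * d = d / (2 * N%:R) + d / (2 * N%:R) by field; rewrite gt_eqF.
  have -> : forall a b c f : R, a - b - (c - f) = (a - c) - (b - f) by move=> *; ring.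
  by rewrite (le_trans (ler_normB _ _))// lerD//; lra.
move=> /le_trans; apply; rewrite subrr normr0 addr0 sumr_const card_ord.
by rewrite -mulr_natr le_eqVlt; apply/orP; left; apply/eqP; field; rewrite gt_eqF.
Qed.

Lemma open_discrete_rate_gt N (a : R) : (0 < N)%N ->
  open [set phi : excursion R | a < discrete_rate N phi].
Proof.
move=> N0; rewrite openE => phi /= aphi; rewrite /interior -nbhs_ballE.
have e0 : 0 < (discrete_rate N phi - a) / 2 by rewrite divr_gt0// subr_gt0.
have [d d0 dd] := discrete_rate_unif_continuous N0 e0.
exists d => // psi; rewrite excursion_ballE/= => /dd.
by rewrite ler_norml => /andP[]; lra.
Qed.

Lemma H231_ge0 phi : (0 <= H231 phi)%E.
Proof.
apply: mule_ge0 => //; apply: integral_ge0 => t _; rewrite lee_fin; exact: J_ge0.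
Qed.

(** [H231] is a supremum of continuous functions. *)
Lemma H231_lsc : lower_semicontinuous (@H231 R).
Proof.
move=> phi a /H231_gt_discrete_rate [N N0 aN].
exists [set psi : excursion R | a < discrete_rate N psi].
  by apply: open_nbhs_nbhs; split => //; exact: open_discrete_rate_gt.
move=> psi /= apsi; apply: lt_le_trans (discrete_rate_le_H231 psi N0).
by rewrite lte_fin.
Qed.

End excursion_space.

(** * From 231-avoiding permutations to Dyck words *)

Section initial_segments.
Local Open Scope nat_scope.

Lemma sum_bool_le n (P : 'I_n -> bool) : \sum_(i < n) P i <= n.
Proof.
apply: (@leq_trans (\sum_(i < n) 1)); first by apply: leq_sum => i _; case: (P i).
by rewrite sum_nat_const card_ord muln1.
Qed.

(** A set of integers that is closed downwards is determined by its size. *)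
Lemma initial_segment_count (P : pred nat) n :
    (forall a b, a <= b -> b < n -> P b -> P a) ->
  forall k, k < n -> P k = (k < \sum_(i < n) P i).
Proof.
elim: n => // n IH down k; rewrite ltnS big_ord_recr/= => kn.
have [Pn|Pn] := boolP (P n).
  rewrite (down _ _ kn)//; apply/esym; rewrite addn1 ltnS (leq_trans kn)//.
  apply: (@leq_trans (\sum_(i < n) 1)); first by rewrite sum_nat_const card_ord muln1.
  by apply: leq_sum => i _; rewrite (down i n)// ltnW.
rewrite addn0; move: kn; rewrite leq_eqVlt => /predU1P[->|kn].
  by rewrite (negbTE Pn) ltnNge sum_bool_le.
by apply: IH => // a b ab bn; apply: down => //; exact: ltnW.
Qed.

Lemma sum_lt_ord n m : m <= n -> \sum_(i < n) (i < m) = m.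
Proof.
elim: n m => [|n IH] m; first by rewrite leqn0 => /eqP->; rewrite big_ord0.
rewrite big_ord_recr/= leq_eqVlt => /predU1P[->|]; last first.
  by rewrite ltnS => mn; rewrite IH// ltnNge mn addn0.
rewrite ltnSn -[RHS]addn1; congr (_ + _).
rewrite -[RHS](IH n)//; apply: eq_bigr => i _.
by rewrite ltn_ord (ltn_trans (ltn_ord i)).
Qed.

End initial_segments.

Section rlm_words.
Local Open Scope nat_scope.
Variable n : nat.
Implicit Types s t : 'S_n.

(** The default value [n] makes this the height at which the path ends when
    [k = n]. *)
Definition suffix_min s (k : nat) : nat := \big[minn/n]_(i < n | k <= i) s i.

Lemma suffix_min_le s k (i : 'I_n) : k <= i -> suffix_min s k <= s i.
Proof.
move=> ki; rewrite /suffix_min; have := mem_index_enum i.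
elim: (index_enum _) => //= x r IH; rewrite inE big_cons => /predU1P[<-|/IH le].
  by rewrite ki geq_minl.
by case: ifP => // _; rewrite geq_min le orbT.
Qed.

Lemma suffix_minP s k m : m <= n ->
  (forall i : 'I_n, k <= i -> m <= s i) -> m <= suffix_min s k.
Proof.
move=> mn H; rewrite /suffix_min; elim/big_ind: _ => // x y mx my.
by rewrite leq_min mx.
Qed.

Lemma suffix_min_attained s k : k < n -> exists2 i : 'I_n, k <= i & s i = suffix_min s k :> nat.
Proof.
move=> kn; have [i ki imin] := @arg_minnP _ (Ordinal kn) (fun i : 'I_n => k <= i)
  (fun i => nat_of_ord (s i)) (leqnn _).
exists i => //; apply/eqP; rewrite eqn_leq suffix_min_le// andbT.
by apply: suffix_minP => //; exact: ltnW.
Qed.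

Lemma suffix_min_mono s k l : k <= l -> suffix_min s k <= suffix_min s l.
Proof.
move=> kl; apply: suffix_minP => [|i li].
  rewrite /suffix_min; elim/big_ind: _ => // [x y xn yn|i _].
    by rewrite geq_min xn.
  exact: ltnW.
by apply: suffix_min_le; exact: leq_trans li.
Qed.

Lemma suffix_min_out s k : n <= k -> suffix_min s k = n.
Proof.
move=> nk; rewrite /suffix_min big_pred0// => i.
by apply/negbTE; rewrite -ltnNge (leq_trans _ nk).
Qed.

Lemma suffix_min_le_size s k : suffix_min s k <= n.
Proof.
by rewrite -(suffix_min_out s (leq_maxr k n)) suffix_min_mono// leq_maxl.
Qed.

(** The [n - k] entries from position [k] on are distinct and at least
    [suffix_min s k], so there is room for them only if [suffix_min s k <= k]. *)
Lemma suffix_min_le_pos s k : k <= n -> suffix_min s k <= k.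
Proof.
move=> kn; set m := suffix_min s k.
have mn : m <= n := suffix_min_le_size s k.
have card_ge a : a <= n -> #|[set i : 'I_n | a <= i]%SET| = n - a.
  move=> an; rewrite -sum1dep_card.
  have total : \sum_(i < n) 1 = n by rewrite sum_nat_const card_ord muln1.
  rewrite (bigID (fun i : 'I_n => a <= i))/= in total.
  have below : \sum_(i < n | ~~ (a <= i)) 1 = a.
    rewrite -[RHS](sum_lt_ord an) [LHS]big_mkcond/=.
    by apply: eq_bigr => i _; rewrite -ltnNge; case: ltnP.
  by rewrite below in total; rewrite -[in RHS]total addnK.
have : s @: [set i : 'I_n | k <= i]%SET \subset [set i : 'I_n | m <= i]%SET.
  by apply/fintype.subsetP => _ /imsetP[i + ->]; rewrite !inE => ki; exact: suffix_min_le.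
move/subset_leq_card; rewrite card_imset; last exact: perm_inj.
by rewrite !card_ge//; lia.
Qed.

(** The path of a permutation makes its [k]-th East step (counted from 0) after
    [suffix_min s k] North steps, that is, at time [k + suffix_min s k]. *)
Definition east_steps s (j : nat) : nat :=
  \sum_(k < n) (k + suffix_min s k < j).

Lemma east_stepsP s j k : k < n -> (k + suffix_min s k < j) = (k < east_steps s j).
Proof.
move=> kn; rewrite /east_steps.
rewrite -(@initial_segment_count (fun k => k + suffix_min s k < j))// => a b ab bn.
by apply: leq_ltn_trans; rewrite leq_add// suffix_min_mono.
Qed.

Lemma east_steps_le s j : east_steps s j <= n.
Proof. exact: sum_bool_le. Qed.

Lemma east_steps_mono s i j : i <= j -> east_steps s i <= east_steps s j.
Proof.
move=> ij; apply: leq_sum => k _; case: ltnP => // h.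
by rewrite (leq_trans h ij).
Qed.

Lemma east_steps0 s : east_steps s 0 = 0.
Proof. by rewrite /east_steps big1. Qed.

Lemma east_stepsS s j : east_steps s j.+1 <= (east_steps s j).+1.
Proof.
rewrite leqNgt; apply/negP => lt2.
have k1n : (east_steps s j).+1 < n by exact: leq_trans (east_steps_le s j.+1).
have := east_stepsP s j (ltnW k1n); have := east_stepsP s j.+1 k1n.
rewrite lt2 ltnn; have := @suffix_min_mono s _ _ (leqnSn (east_steps s j)); lia.
Qed.

Definition rlm_word s : bitseq :=
  mkseq (fun j => east_steps s j < east_steps s j.+1) n.*2.

Lemma size_rlm_word s : size (rlm_word s) = n.*2.
Proof. by rewrite size_mkseq. Qed.

Lemma count_rlm_word s j : j <= n.*2 ->
  count id (take j (rlm_word s)) = east_steps s j.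
Proof.
elim: j => [|j IH] jn; first by rewrite take0 east_steps0.
rewrite (take_nth false) ?size_rlm_word// -cats1 count_cat IH ?(ltnW jn)//= addn0.
rewrite nth_mkseq//; have := east_stepsS s j; have := east_steps_mono s (leqnSn j).
by case: ltnP; lia.
Qed.

Lemma east_steps_end s : east_steps s n.*2 = n.
Proof.
rewrite /east_steps (eq_bigr (fun=> 1)); first by rewrite sum_nat_const card_ord muln1.
by move=> i _; have := suffix_min_le_pos s (ltnW (ltn_ord i)); have := ltn_ord i; lia.
Qed.

Lemma east_steps_ge s j : j <= n.*2 -> j <= (east_steps s j).*2.
Proof.
move=> jn; rewrite leqNgt; apply/negP => lt.
have kn : east_steps s j < n by lia.
have := east_stepsP s j kn; rewrite ltnn.
have := suffix_min_le_pos s (ltnW kn); lia.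
Qed.

(** For [M = suffix_min s], the number of entries that stack sorting has pushed
    when it outputs [v]. *)
Definition reach (M : nat -> nat) (v : nat) : nat := \sum_(k < n) (M k <= v).

Lemma reachP (M : nat -> nat) v k :
    (forall a b, a <= b -> b < n -> M a <= M b) -> k < n ->
  (M k <= v) = (k < reach M v).
Proof.
move=> Mmono kn; rewrite -(@initial_segment_count (fun k => M k <= v))// => a b ab bn.
by apply: leq_trans; exact: Mmono.
Qed.

Lemma avoids231P s : reflect
  (forall i j k : 'I_n, i < j -> j < k -> s k < s i -> s i < s j -> False)
  (avoids231 s).
Proof.
apply: (iffP idP) => [/forallP H i j k ij jk ki si|H].
  by have /forallP/(_ j)/forallP/(_ k) := H i; rewrite ij jk ki si.
apply/forallP => i; apply/forallP => j; apply/forallP => k.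
by apply/negP => /and4P[]; exact: H.
Qed.

(** Stack sorting outputs [v = s i] when [v] is on top of the stack, so the
    entries pushed after it are smaller.  Otherwise a larger entry at [j] and the
    entry smaller than [v] that comes later form a pattern 231 with [v]. *)
Lemma avoider_top_of_stack s (i j : 'I_n) : avoids231 s ->
  i < j -> j < reach (suffix_min s) (s i) -> s j < s i.
Proof.
move=> /avoids231P av ij.
rewrite -(reachP _ (fun a b ab _ => suffix_min_mono s ab) (ltn_ord j)) => mj.
rewrite ltnNge leq_eqVlt; apply/negP => /orP[/eqP/val_inj/perm_inj ijE|lt].
  by rewrite ijE ltnn in ij.
have [k jk kE] := suffix_min_attained s (ltn_ord j).
have jk' : j < k.
  rewrite ltn_neqAle jk andbT; apply/eqP => /val_inj jkE.
  by move: mj; rewrite -kE -jkE leqNgt lt.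
apply: (av i j k) => //; rewrite ltn_neqAle kE mj andbT -kE.
by apply/eqP => /val_inj/perm_inj kiE; move: jk'; rewrite kiE; lia.
Qed.

(** By induction on [v], the position of [v] is determined: it is the last one
    before [reach (suffix_min s) v] which does not hold a smaller value. *)
Lemma suffix_min_inj s t : avoids231 s -> avoids231 t ->
  (forall k, k < n -> suffix_min s k = suffix_min t k) -> s = t.
Proof.
move=> avs avt st.
have rst v : reach (suffix_min s) v = reach (suffix_min t) v.
  by apply: eq_bigr => k _; rewrite st.
have top (u : 'S_n) (v : 'I_n) : (u^-1)%g v < reach (suffix_min u) v.
  rewrite -(reachP _ (fun a b ab _ => suffix_min_mono u ab) (ltn_ord _)).
  by apply: (leq_trans (suffix_min_le _ (leqnn _))); rewrite permKV.
suff H v : forall v' : 'I_n, v' = v :> nat -> (s^-1)%g v' = (t^-1)%g v'.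
  by apply: invg_inj; apply/permP => v; exact: (H v).
have [m] := ubnP v; elim: m v => // m IH v; rewrite ltnS => vm v' v'v.
wlog lt : s t avs avt st rst IH / (s^-1)%g v' < (t^-1)%g v'.
  move=> W; case: (ltngtP ((s^-1)%g v') ((t^-1)%g v')) => [lt|lt|/val_inj//].
    exact: W lt.
  apply/esym; apply: W lt => //; first by move=> k kn; rewrite st.
  by move=> w wm w' w'w; apply/esym; exact: IH w'w.
have := @avoider_top_of_stack s _ _ avs lt; rewrite permKV rst => /(_ (top t v')) lt'.
have := IH (s ((t^-1)%g v')) _ _ erefl; rewrite permK => H.
have {H} E : (t^-1)%g v' = (t^-1)%g (s ((t^-1)%g v')).
  by apply: H; rewrite -v'v in vm; exact: leq_trans vm.
by move/perm_inj: E lt' => <-; rewrite ltnn.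
Qed.

Lemma rlm_word_inj s t : avoids231 s -> avoids231 t -> rlm_word s = rlm_word t -> s = t.
Proof.
move=> avs avt st; apply: suffix_min_inj => // k kn.
have est j : j <= n.*2 -> east_steps s j = east_steps t j.
  by move=> jn; rewrite -!count_rlm_word// st.
have H j : j <= n.*2 -> (k + suffix_min s k < j) = (k + suffix_min t k < j).
  by move=> jn; rewrite !east_stepsP// est.
have := suffix_min_le_pos s (ltnW kn); have := suffix_min_le_pos t (ltnW kn).
have := H (k + suffix_min s k).+1; have := H (k + suffix_min t k).+1; lia.
Qed.

End rlm_words.

(** * From Dyck words to 231-avoiding permutations *)

Section rlm_word_surjective.
Local Open Scope nat_scope.
Variable n : nat.

(** In an avoider the position of [v] is the last one before the reach of [v]
    that is not taken by a smaller value; the greedy filling imposes this. *)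
Definition last_free (c : nat) (used : seq nat) : nat :=
  \max_(k < c | (k : nat) \notin used) k.

Fixpoint greedy (c : nat -> nat) (v : nat) : seq nat :=
  if v is v'.+1 then rcons (greedy c v') (last_free (c v') (greedy c v')) else [::].

Lemma size_greedy c v : size (greedy c v) = v.
Proof. by elim: v => //= v IH; rewrite size_rcons IH. Qed.

Lemma last_freeP c used : size used < c ->
  [/\ last_free c used < c, last_free c used \notin used &
      forall k, last_free c used < k -> k < c -> k \in used].
Proof.
move=> uc; have [k0 k0u] : exists k : 'I_c, (k : nat) \notin used.
  apply/existsP; apply: contraLR uc; rewrite negb_exists -leqNgt => /forallP H.
  rewrite -{1}(size_iota 0 c); apply: uniq_leq_size; first exact: iota_uniq.
  by move=> k; rewrite mem_iota add0n => /= kc; have := H (Ordinal kc); rewrite negbK.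
rewrite /last_free.
have [k ku kmax] := @arg_maxnP _ k0 (fun k : 'I_c => (k : nat) \notin used)
  (fun k => nat_of_ord k) k0u.
have -> : \max_(k < c | (k : nat) \notin used) k = k.
  apply/eqP; rewrite eqn_leq (@leq_bigmax_cond _ _ (fun k : 'I_c => k : nat) k)// andbT.
  by apply/bigmax_leqP => j; exact: kmax.
split => // j kj jc; apply: contraLR kj => ju.
by rewrite -leqNgt; exact: (kmax (Ordinal jc)).
Qed.

Lemma mem_greedy c v k : k \in greedy c v ->
  exists2 u, u < v & k = last_free (c u) (greedy c u).
Proof.
elim: v => //= v IH; rewrite mem_rcons inE => /predU1P[->|/IH[u uv ->]].
  by exists v.
by exists u => //; exact: ltnW.
Qed.

Lemma greedy_mem c u v : u < v -> last_free (c u) (greedy c u) \in greedy c v.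
Proof.
elim: v => //= v IH; rewrite ltnS leq_eqVlt mem_rcons inE => /predU1P[->|/IH ->].
  by rewrite eqxx.
by rewrite orbT.
Qed.

Lemma greedy_permutation c :
    (forall v, v < n -> v < c v) -> (forall v, v < n -> c v <= n) ->
  exists p : {perm 'I_n}, forall v : 'I_n, p v < c v /\
    forall j : 'I_n, p v < j -> j < c v -> exists2 u : 'I_n, u < v & p u = j.
Proof.
move=> vc cn; pose q v := last_free (c v) (greedy c v).
have qP v : v < n -> [/\ q v < c v, q v \notin greedy c v &
    forall k, q v < k -> k < c v -> k \in greedy c v].
  by move=> vn; apply: last_freeP; rewrite size_greedy vc.
have qn (v : 'I_n) : q v < n.
  by have [qc _ _] := qP v (ltn_ord v); exact: leq_trans (cn _ (ltn_ord v)).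
have q_lt (u v : 'I_n) : u < v -> q u <> q v.
  by move=> uv quv; have [_ /negP[]] := qP v (ltn_ord v); rewrite -quv greedy_mem.
pose p0 (v : 'I_n) : 'I_n := Ordinal (qn v).
have p0_inj : injective p0.
  move=> u v quv; have {}quv : q u = q v := congr1 (@nat_of_ord n) quv.
  case: (ltngtP u v) => [/q_lt//|/q_lt vu|/val_inj//].
  by case: vu.
exists (perm p0_inj) => v; rewrite permE/=; have [qc _ qmax] := qP v (ltn_ord v).
split => // j vj jc; have [u uv jE] := mem_greedy (qmax j vj jc).
exists (Ordinal (ltn_trans uv (ltn_ord v))) => //.
by rewrite permE; apply: val_inj.
Qed.

(** The greedy permutation sends values to positions, so its inverse is taken.  By
    maximality of the greedy choice, all entries between the position of [v] and
    its reach are smaller than [v], which excludes the pattern 231. *)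
Lemma suffix_min_surj (M : nat -> nat) :
    (forall a b, a <= b -> b < n -> M a <= M b) -> (forall k, k < n -> M k <= k) ->
  exists2 s : 'S_n, avoids231 s & forall k, k < n -> suffix_min s k = M k.
Proof.
move=> Mmono Mle; set c := reach n M.
have cP v k : k < n -> (M k <= v) = (k < c v) by exact: reachP.
have vc v : v < n -> v < c v by move=> vn; rewrite -cP// Mle.
have cn v : v < n -> c v <= n by move=> _; exact: sum_bool_le.
have [p pP] := greedy_permutation vc cn.
exists (p^-1)%g.
  apply/avoids231P => i j k ij jk ki iltj.
  have [_ pmax] := pP ((p^-1)%g i); rewrite permKV in pmax.
  have kc : k < c ((p^-1)%g i).
    have [kc _] := pP ((p^-1)%g k); rewrite permKV in kc.
    by move: kc; rewrite -!cP// => /leq_trans; apply; exact: ltnW.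
  have [u ui pu] := pmax j ij (ltn_trans jk kc).
  by move: iltj; rewrite -pu permK ltnNge ltnW.
move=> k kn; apply/eqP; rewrite eqn_leq; apply/andP; split; last first.
  apply: suffix_minP; first by rewrite (leq_trans (Mle k kn))// ltnW.
  move=> i ki; have [ic _] := pP ((p^-1)%g i); rewrite permKV -cP// in ic.
  by apply: leq_trans ic; exact: Mmono.
have Mn : M k < n by exact: leq_ltn_trans (Mle k kn) kn.
pose v := Ordinal Mn; have [pc pmax] := pP v.
suff kp : k <= p v by have := suffix_min_le (p^-1)%g kp; rewrite permK.
have kc : k < c v by rewrite -cP.
rewrite leqNgt; apply/negP => pk.
have [u uv pu] := pmax (Ordinal kn) pk kc.
have [uc _] := pP u; rewrite pu/= -cP// in uc.
by move: uv; rewrite ltnNge uc.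
Qed.

(** The prefix before the [k]-th East step determines the [k]-th suffix minimum,
    and the Dyck condition says that it is at most [k]. *)
Lemma rlm_word_surj (w : bitseq) :
    size w = n.*2 -> count id w = n ->
    (forall j, j <= n.*2 -> j <= (count id (take j w)).*2) ->
  exists2 s : 'S_n, avoids231 s & rlm_word s = w.
Proof.
move=> sw cw dyck; pose X j := count id (take j w).
have XS j : j < n.*2 -> X j.+1 = X j + nth false w j.
  by move=> jn; rewrite /X (take_nth false) ?sw// -cats1 count_cat/= addn0.
have Xmono i j : i <= j -> X i <= X j.
  move=> ij; rewrite /X -(subnKC ij) takeD count_cat; exact: leq_addr.
have Xle j : X j <= j.
  by rewrite /X (leq_trans (count_size _ _))// size_take; case: ltnP => // /ltnW.
have X2n : X n.*2 = n by rewrite /X -sw take_size.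
(* [T k] is the time of the [k]-th East step of [w]. *)
pose T k := \sum_(j < n.*2) (X j.+1 <= k).
have TP k j : j < n.*2 -> (X j.+1 <= k) = (j < T k).
  move=> jn; rewrite -(@initial_segment_count (fun j => X j.+1 <= k))// => a b ab _.
  by apply: leq_trans; exact: Xmono.
have TX k j : j <= n.*2 -> (T k < j) = (k < X j).
  case: j => [|j] jn; first by rewrite ltn0 /X take0.
  by rewrite ltnS leqNgt -TP// -ltnNge.
have T2n k : T k <= n.*2 by exact: sum_bool_le.
have Tge k : k < n -> k <= T k.
  move=> kn; rewrite leqNgt TX; last by rewrite -addnn (leq_trans (ltnW kn))// leq_addr.
  by rewrite -leqNgt.
have Tle k : k < n -> T k <= k.*2.
  move=> kn; have k2 : k.*2.+1 <= n.*2 by lia.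
  have := dyck _ k2; rewrite -/(X _) => XX.
  by rewrite -ltnS TX//; lia.
have Tlt k : k < n -> T k < n.*2 by move=> kn; rewrite TX// X2n.
have TS k : k.+1 < n -> T k < T k.+1.
  move=> kn; have Tn := Tlt _ (ltnW kn).
  rewrite -TP// XS//; have := TX k (T k) (T2n k); rewrite ltnn.
  by case: nth; lia.
pose M k := T k - k.
have Mmono a b : a <= b -> b < n -> M a <= M b.
  elim: b => [|b IH]; first by rewrite leqn0 => /eqP->.
  rewrite leq_eqVlt => /predU1P[->//|ab bn].
  apply: (leq_trans (IH ab (ltnW bn))); rewrite /M.
  have := TS b bn; lia.
have Mle k : k < n -> M k <= k by move=> kn; rewrite /M; have := Tle k kn; lia.
have [s avs sM] := suffix_min_surj Mmono Mle.
exists s => //.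
have E j : j <= n.*2 -> east_steps s j = X j.
  move=> jn; rewrite /east_steps -[RHS](@sum_lt_ord n); last by rewrite -X2n Xmono.
  apply: eq_bigr => k _; rewrite sM// /M subnKC ?TX//; exact: Tge.
apply: (@eq_from_nth _ false); first by rewrite size_rlm_word sw.
move=> j; rewrite size_rlm_word => jn; rewrite nth_mkseq// !E// ?XS//; last exact: ltnW.
by case: nth; lia.
Qed.

End rlm_word_surjective.

(** * The rescaled path of a permutation *)

Section rotated_curve_values.
Variables (R : realType) (n : nat) (s : 'S_n).
Hypothesis n_gt0 : (0 < n)%N.
Let M := suffix_min s.
Let f : R -> R := rlm_curve s.

Let nR : 0 < n%:R :> R. Proof. by rewrite ltr0n. Qed.

Lemma rlm_curveE (x : R) : 0 <= x -> x <= 1 -> f x = (M (Num.trunc (n%:R * x)))%:R / n%:R.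
Proof.
move=> x0 x1; rewrite /f /rlm_curve; case: ltP => [x1'|x1'].
  congr (_%:R / _); rewrite /M /suffix_min; apply: eq_bigl => i.
  by rewrite Num.Theory.truncn_le_nat.
have -> : x = 1 by apply/eqP; rewrite eq_le x1.
by rewrite mulr1 Num.Theory.natrK /M suffix_min_out// divff// gt_eqF.
Qed.

Lemma left_limit_rlm_curve_le (x y : R) : 0 <= x -> x <= 1 -> 0 <= y ->
  left_limit f x <= y <-> forall i : nat, i%:R < n%:R * x -> (M i)%:R <= n%:R * y.
Proof.
move=> x0 x1 y0; rewrite /left_limit; case: eqVneq => [->|xn0].
  by split => // _ i; rewrite mulr0 ltrn0.
have {xn0}x0 : 0 < x by rewrite lt_neqAle eq_sym xn0.
have nx0 : 0 < n%:R * x by rewrite mulr_gt0.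
have [k kx xk] : exists2 k : nat, k%:R < n%:R * x & n%:R * x <= k.+1%:R.
  have ex : exists m, n%:R * x <= m%:R.
    by exists (Num.trunc (n%:R * x)).+1; rewrite ltW// Num.Theory.truncnS_gt.
  case: (ex_minnP ex) => -[|m]; first by rewrite leNgt nx0.
  by move=> xm min_m; exists m => //; rewrite ltNge; apply/negP => /min_m; rewrite ltnn.
have -> : lim (f z @[z --> x^'-]) = (M k)%:R / n%:R.
  apply/cvg_lim => //; apply: cvg_near_cst; near=> z.
  have zx : z < x by near: z; exact: nbhs_left_lt.
  have kz : k%:R / n%:R < z by near: z; apply: nbhs_left_gt; rewrite ltr_pdivrMr// mulrC.
  have z0 : 0 <= z by rewrite (le_trans _ (ltW kz))// divr_ge0.
  rewrite rlm_curveE//; last by rewrite (le_trans (ltW zx)).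
  congr ((M _)%:R / _); apply: Num.Theory.truncn_def.
  rewrite ltr_pdivrMr// mulrC in kz; rewrite ltW//= (lt_le_trans _ xk)//.
  by rewrite ltr_pM2l.
rewrite ler_pdivrMr// mulrC; split => [My i ix|]; last exact.
apply: le_trans My; rewrite ler_nat; apply: suffix_min_mono.
by rewrite -ltnS -(ltr_nat R) (lt_le_trans ix).
Unshelve. all: by end_near. Qed.

Let G : set (R * R) := completed_graph f.

Lemma graphP (x y : R) : G (x, y) <->
  [/\ 0 <= x <= 1, 0 <= y <= 1, forall i : nat, i%:R < n%:R * x -> (M i)%:R <= n%:R * y &
      n%:R * y <= (M (Num.trunc (n%:R * x)))%:R].
Proof.
rewrite /G /completed_graph/= !in_itv/=; split.
  move=> [/andP[x0 x1] /andP[y0 y1] /andP[fy yf]]; split; [exact/andP|exact/andP| |].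
    by apply/left_limit_rlm_curve_le.
  by move: yf; rewrite rlm_curveE// ler_pdivlMr// mulrC.
move=> [/andP[x0 x1] /andP[y0 y1] fy yf]; split; [exact/andP|exact/andP|].
apply/andP; split; first exact/left_limit_rlm_curve_le.
by rewrite rlm_curveE// ler_pdivlMr// mulrC.
Qed.

(** The completed graph of a nondecreasing function is a chain for the product
    order. *)
Lemma graph_monotone (x y x' y' : R) : G (x, y) -> G (x', y') -> x < x' -> y <= y'.
Proof.
move=> /graphP[/andP[x0 x1] _ _ yf] /graphP[_ _ fy' _] xx'.
rewrite -(ler_pM2l nR); apply: le_trans yf _; apply: fy'.
have /andP[h _] : (Num.trunc (n%:R * x))%:R <= n%:R * x < (Num.trunc (n%:R * x)).+1%:R.
  by apply: Num.Theory.truncn_itv; rewrite mulr_ge0.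
by rewrite (le_lt_trans h)// ltr_pM2l.
Qed.

Lemma graph_below_diagonal (x y : R) : G (x, y) -> y <= x.
Proof.
move=> /graphP[/andP[x0 x1] _ _ yf]; rewrite -(ler_pM2l nR); apply: le_trans yf _.
have nx0 : 0 <= n%:R * x by rewrite mulr_ge0.
have /andP[h _] := Num.Theory.truncn_itv nx0.
apply: le_trans h; rewrite ler_nat suffix_min_le_pos//.
rewrite -ltnS Num.Theory.truncn_lt_nat// (@le_lt_trans _ _ n%:R) ?ltr_nat//.
by rewrite ler_piMr.
Qed.

(** The point reached after [j] complete steps and a fraction [r] of the next one;
    whether this step goes East or North is read off [east_stepsP]. *)
Lemma graph_at_time (j : nat) (r : R) : (j < n.*2)%N -> 0 <= r -> r < 1 ->
  exists x y, [/\ G (x, y), x + y = (j%:R + r) / n%:R &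
    r = 0 -> x = (east_steps s j)%:R / n%:R].
Proof.
move=> jn r0 r1; set X := east_steps s j.
have Xj : (X <= j)%N.
  by rewrite /X -count_rlm_word ?(ltnW jn)// (leq_trans (count_size _ _))// size_take;
    case: ltnP => // /ltnW.
pose Y := (j - X)%N; have jE : j%:R = X%:R + Y%:R :> R by rewrite -natrD subnKC.
have Xn : (X <= n)%N := east_steps_le s j.
have Yn : (Y <= n)%N by have := east_steps_ge s (ltnW jn); rewrite -/X /Y; lia.
have bnd (a : nat) (t : R) : 0 <= a%:R + t -> a%:R + t <= n%:R -> 0 <= (a%:R + t) / n%:R <= 1.
  by move=> h1 h2; rewrite divr_ge0 ?ler0n//= ler_pdivrMr// mul1r.
have cancel t : n%:R * (t / n%:R) = t :> R by rewrite mulrC divfK// gt_eqF.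
have trX (t : R) : 0 <= t -> t < 1 -> Num.trunc (X%:R + t) = X.
  by move=> t0 t1; apply: Num.Theory.truncn_def; rewrite lerDl t0 -natr1 ltrD2l.
have [east|north] := ltnP X (east_steps s j.+1).
  have XltN : (X < n)%N by exact: leq_trans (east_steps_le s j.+1).
  have MY : M X = Y.
    have := east_stepsP s j XltN; have := east_stepsP s j.+1 XltN.
    by rewrite east -/X ltnn /Y -/M; lia.
  exists ((X%:R + r) / n%:R), (Y%:R / n%:R); split.
  - apply/graphP; rewrite !cancel trX// MY; split => //.
    + have : X.+1%:R <= n%:R :> R by rewrite ler_nat.
      by rewrite -natr1 => ?; apply: bnd; [rewrite addr_ge0|lra].
    + by have := bnd Y 0; rewrite addr0; apply; rewrite ?ler0n ?ler_nat.
    + move=> i iX; rewrite -MY ler_nat; apply: suffix_min_mono.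
      by rewrite -ltnS -(ltr_nat R) (lt_le_trans iX)// -natr1 lerD2l ltW.
  - by rewrite jE; field; rewrite gt_eqF.
  - by move=> ->; rewrite addr0.
have MY : (Y < M X)%N.
  have [XltN|nX] := ltnP X n.
    by have := east_stepsP s j.+1 XltN; move: north; rewrite /Y -/M; lia.
  by rewrite /M suffix_min_out//; rewrite /Y; lia.
have MYR : Y.+1%:R <= (M X)%:R :> R by rewrite ler_nat.
have YR : (M X)%:R <= n%:R :> R by rewrite ler_nat; exact: suffix_min_le_size.
exists (X%:R / n%:R), ((Y%:R + r) / n%:R); split => //.
- apply/graphP; rewrite !cancel; split.
  + by have := bnd X 0; rewrite addr0; apply; rewrite ?ler0n ?ler_nat.
  + by rewrite -natr1 in MYR; apply: bnd; [rewrite addr_ge0|lra].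
  + move=> i; rewrite ltr_nat => iX.
    have XltN : (X.-1 < n)%N by lia.
    have := east_stepsP s j XltN; rewrite -/X => h.
    have MX1 : (M X.-1 <= Y)%N by move: h; rewrite /Y -/M; lia.
    apply: (@le_trans _ _ Y%:R); last by rewrite lerDl.
    by rewrite ler_nat (leq_trans _ MX1)// suffix_min_mono//; lia.
  + by have := trX 0; rewrite addr0 => ->//; rewrite -natr1 in MYR; lra.
- by rewrite jE; field; rewrite gt_eqF.
Qed.

Lemma graph_end : G (1, 1).
Proof.
apply/graphP; rewrite !mulr1 Num.Theory.natrK /M suffix_min_out// lexx ler01.
by split => // i _; rewrite ler_nat suffix_min_le_size.
Qed.

Lemma graph_ex (t : R) : 0 <= t -> t <= 1 -> exists v, G (t + v, t - v).
Proof.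
move=> t0; rewrite le_eqVlt => /predU1P[->|t1].
  by exists 0; rewrite addr0 subr0; exact: graph_end.
have tn0 : 0 <= 2 * n%:R * t by rewrite !mulr_ge0.
have /andP[jt tj] := Num.Theory.truncn_itv tn0; set j := Num.trunc _ in jt tj.
have jn : (j < n.*2)%N.
  rewrite -(ltr_nat R) -mul2n natrM (le_lt_trans jt)// -[ltRHS]mulr1 ltr_pM2l//.
  by rewrite mulr_gt0.
have r0 : 0 <= 2 * n%:R * t - j%:R by rewrite subr_ge0.
have r1 : 2 * n%:R * t - j%:R < 1 by rewrite ltrBlDl natr1.
have [x [y [Gxy xy _]]] := graph_at_time jn r0 r1.
have {}xy : x + y = 2 * t by rewrite xy; field; rewrite gt_eqF.
exists ((x - y) / 2); have -> : t + (x - y) / 2 = x by lra.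
by have -> : t - (x - y) / 2 = y by lra.
Qed.

(** In rotated coordinates, comparable points differ by a vector whose second
    coordinate is bounded by the first one. *)
Lemma graph_lipschitz (t u v w : R) : G (t + v, t - v) -> G (u + w, u - w) ->
  `|v - w| <= `|t - u|.
Proof.
wlog tu : t u v w / t + v <= u + w.
  move=> W Gt Gu; have [le|/ltW le] := leP (t + v) (u + w); first exact: W.
  by rewrite distrC [leRHS]distrC; exact: W.
move=> Gt Gu; have vw : t - v <= u - w \/ t + v = u + w.
  move: tu; rewrite le_eqVlt => /predU1P[->|tu]; first by right.
  by left; exact: graph_monotone Gt Gu tu.
rewrite ler_norml; case: vw => vw; have [tu'|tu'] := leP t u.
- by rewrite ler0_norm ?subr_le0//; apply/andP; split; lra.
- by rewrite gtr0_norm ?subr_gt0//; apply/andP; split; lra.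
- by rewrite ler0_norm ?subr_le0//; apply/andP; split; lra.
- by rewrite gtr0_norm ?subr_gt0//; apply/andP; split; lra.
Qed.

Lemma rotated_curve_ex : exists phi : excursion R,
  completed_graph f = [set (t + phi t, t - phi t) | t in `[0, 1]].
Proof.
have /choice[phi phiE] : forall t : R, exists v,
    (t \in `[0, 1] -> G (t + v, t - v)) /\ (t \notin `[0, 1] -> v = 0).
  move=> t; have [t01|t01] := boolP (t \in `[0, 1]); last by exists 0.
  move: (t01); rewrite in_itv/= => /andP[t0 t1].
  by have [v Gv] := graph_ex t0 t1; exists v.
have Gphi t : t \in `[0, 1] -> G (t + phi t, t - phi t) := (phiE t).1.
have i0 : (0 : R) \in `[0, 1] by rewrite in_itv/= lexx ler01.
have i1 : (1 : R) \in `[0, 1] by rewrite in_itv/= lexx ler01.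
have lip : 1.-lipschitz_`[0, 1] phi.
  move=> [t u] /= [t01 u01]; rewrite mul1r.
  exact: graph_lipschitz (Gphi _ t01) (Gphi _ u01).
have ge0 t : t \in `[0, 1] -> 0 <= phi t.
  by move=> /Gphi/graph_below_diagonal; lra.
have at0 : phi 0 = 0.
  by have /graphP[/andP[? ?] /andP[? ?] _ _] := Gphi 0 i0; lra.
have at1 : phi 1 = 0.
  by have /graphP[/andP[? ?] /andP[? ?] _ _] := Gphi 1 i1; lra.
exists (Excursion lip ge0 at0 at1 (fun t => (phiE t).2)).
apply/seteqP; split => [[x y] Gxy|_ /= [t t01 <-]]; last exact: Gphi.
have /graphP[/andP[x0 x1] /andP[y0 y1] _ _] := Gxy.
have t01 : (x + y) / 2 \in `[0, 1] by rewrite in_itv/=; apply/andP; split; lra.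
exists ((x + y) / 2) => //=; set t := (x + y) / 2 in t01 *.
have xE : x = t + (x - y) / 2 by rewrite /t; lra.
have yE : y = t - (x - y) / 2 by rewrite /t; lra.
have Gxy' : G (t + (x - y) / 2, t - (x - y) / 2) by rewrite -xE -yE.
have := graph_lipschitz (Gphi t t01) Gxy'.
rewrite subrr normr0 normr_le0 subr_eq0 => /eqP ->.
by rewrite -xE -yE.
Qed.

(** The lattice points of the path lie on the completed graph, which determines
    the rotated curve. *)
Lemma rotated_curve_lattice (j : nat) : (j <= n.*2)%N ->
  rotated_curve R s (j%:R / (2 * n%:R)) =
  (2 * (east_steps s j)%:R - j%:R) / (2 * n%:R).
Proof.
move=> jn; rewrite /rotated_curve; case: xgetP => [phi _ phiE|H]; last first.
  by have [phi phiE] := rotated_curve_ex; case: (H phi).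
have [x [y [Gxy xy xE]]] : exists x y : R, [/\ G (x, y), x + y = j%:R / n%:R &
    x = (east_steps s j)%:R / n%:R].
  move: jn; rewrite leq_eqVlt => /predU1P[->|jn].
    exists 1, 1; split; first exact: graph_end.
      by rewrite -mul2n natrM mulfK// gt_eqF.
    by rewrite east_steps_end divff// gt_eqF.
  have [x [y [Gxy xy xE]]] := graph_at_time jn (lexx 0) ltr01.
  by exists x, y; rewrite addr0 in xy; split => //; exact: xE.
have : completed_graph (rlm_curve s) (x, y) by [].
rewrite phiE => -[t t01 [tx ty]].
have tE : t = j%:R / (2 * n%:R).
  have -> : t = (x + y) / 2 by rewrite -tx -ty; lra.
  by rewrite xy; field; rewrite gt_eqF.
rewrite -tE.
have -> : phi t = x - t by rewrite -tx; ring.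
by rewrite tE xE; field; rewrite gt_eqF.
Qed.

End rotated_curve_values.

(** * Counting words by their contents in blocks *)

Section block_words.
Local Open Scope nat_scope.

Fixpoint words (l u : nat) : seq bitseq :=
  if l is l'.+1 then
    [seq false :: w | w <- words l' u] ++
    (if u is u'.+1 then [seq true :: w | w <- words l' u'] else [::])
  else if u is 0 then [:: [::]] else [::].

Lemma size_words l u : size (words l u) = 'C(l, u).
Proof.
elim: l u => [|l IH] [|u] //=; rewrite size_cat !size_map !IH ?bin0//.
Qed.

Lemma mem_words l u w : (w \in words l u) = (size w == l) && (count id w == u).
Proof.
elim: l u w => [|l IH] u w /=.
  by case: w => [|b w]; case: u => [|u]; rewrite ?inE ?in_nil.
rewrite mem_cat; case: w => [|b w] /=.
  have nil_cons c (s : seq bitseq) : ([::] \in [seq c :: x | x <- s]) = false.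
    by apply/negbTE/mapP => -[].
  by rewrite nil_cons; case: u => [|u]; rewrite ?in_nil ?nil_cons.
have mem_cons c (s : seq bitseq) : (b :: w \in [seq c :: x | x <- s]) = (b == c) && (w \in s).
  apply/mapP/andP => [[x xs [-> ->]]|[/eqP -> ws]]; first by rewrite eqxx.
  by exists w.
case: u => [|u]; rewrite !mem_cons ?in_nil !IH eqSS;
  clear mem_cons; case: b => /=; rewrite ?orbF ?andbF ?add0n ?add1n ?eqSS//.
Qed.

Lemma words_uniq l u : uniq (words l u).
Proof.
elim: l u => [|l IH] [|u] //=; rewrite cat_uniq !map_inj_uniq ?IH//=; try by move=> ? ? [].
rewrite andbT; apply/hasPn => _ /mapP[w _ ->]; apply/negP => /mapP[x _] [].
by [].
Qed.

Lemma nat_homo_leq (k : nat -> nat) : (forall i, k i <= k i.+1) ->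
  forall i j, i <= j -> k i <= k j.
Proof.
move=> kS i; elim=> [|j IH]; first by rewrite leqn0 => /eqP ->.
by rewrite leq_eqVlt => /predU1P[->//|/IH ij]; exact: leq_trans ij (kS j).
Qed.

(** The mode of the binomial distribution of parameters [l] and [u / l] is [u]: the
    ratio of consecutive terms is at least 1 before [u] and at most 1 after it. *)
Lemma binomial_mode l u v : u <= l -> v <= l ->
  'C(l, v) * (u ^ v * (l - u) ^ (l - v)) <= 'C(l, u) * (u ^ u * (l - u) ^ (l - u)).
Proof.
move=> ul; pose T v := 'C(l, v) * (u ^ v * (l - u) ^ (l - v)).
rewrite -/(T v) -/(T u).
have TS w : w < l -> T w.+1 * (w.+1 * (l - u)) = T w * ((l - w) * u).
  move=> wl; rewrite /T; have H := mul_bin_left l w.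
  have -> : (l - u) ^ (l - w) = (l - u) * (l - u) ^ (l - w.+1).
    by rewrite -expnS; congr (_ ^ _); lia.
  rewrite expnS; transitivity
    ((w.+1 * 'C(l, w.+1)) * (u * u ^ w * (l - u) ^ (l - w.+1) * (l - u))); first ring.
  by rewrite H; ring.
have up w : w < u -> T w <= T w.+1.
  move=> wu; have wl : w < l by exact: leq_trans ul.
  have B0 : 0 < (l - w) * u by rewrite muln_gt0 subn_gt0 wl (leq_ltn_trans _ wu).
  rewrite -(leq_pmul2r B0) -TS// leq_mul2l; apply/orP; right.
  by rewrite mulnC leq_mul//; lia.
have down w : u <= w -> w < l -> T w.+1 <= T w.
  move=> uw wl; have A0 : 0 < w.+1 * (l - u) by rewrite muln_gt0 subn_gt0 (leq_ltn_trans uw).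
  rewrite -(leq_pmul2r A0) TS// leq_mul2l; apply/orP; right.
  by rewrite mulnC leq_mul//; lia.
move=> vl; have [uv|/ltnW vu] := leqP u v.
  elim: v uv vl => [|v IH]; first by rewrite leqn0 => /eqP ->.
  rewrite leq_eqVlt => /predU1P[->//|uv vl].
  by apply: leq_trans (IH uv (ltnW vl)); exact: down.
rewrite -(subKn vu); elim: (u - v) => [|d IH]; first by rewrite subn0.
apply: leq_trans IH; have [du|ud] := ltnP d u.
  by rewrite -(subnSK du); apply: up; rewrite ltn_subrL (leq_ltn_trans _ du).
have -> : u - d = 0 by apply/eqP; rewrite subn_eq0.
by have -> : u - d.+1 = 0 by apply/eqP; rewrite subn_eq0 leqW.
Qed.

Lemma pow_binomial l u : u <= l ->
  l ^ l = \sum_(v < l.+1) 'C(l, v) * (u ^ v * (l - u) ^ (l - v)).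
Proof.
move=> ul; transitivity ((l - u + u) ^ l); first by rewrite subnK.
by rewrite expnDn; apply: eq_bigr => v _; rewrite [u ^ v * _]mulnC.
Qed.

Lemma binomial_le_pow l u : u <= l ->
  'C(l, u) * (u ^ u * (l - u) ^ (l - u)) <= l ^ l.
Proof.
move=> ul; rewrite [leqRHS](pow_binomial ul).
by rewrite (bigD1 (Ordinal (ul : u < l.+1)))//= leq_addr.
Qed.

Lemma pow_le_binomial l u : u <= l ->
  l ^ l <= l.+1 * ('C(l, u) * (u ^ u * (l - u) ^ (l - u))).
Proof.
move=> ul; rewrite [leqLHS](pow_binomial ul) -[l.+1 in leqRHS]card_ord -sum_nat_const.
by apply: leq_sum => v _; apply: binomial_mode => //; rewrite -ltnS.
Qed.

Variables k x : nat -> nat.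

Fixpoint block_words (N : nat) : seq bitseq :=
  if N is N'.+1 then
    [seq v ++ w | v <- block_words N', w <- words (k N'.+1 - k N') (x N'.+1 - x N')]
  else [:: [::]].

Hypotheses (k0 : k 0 = 0) (x0 : x 0 = 0).
Hypothesis k_mono : forall i, k i <= k i.+1.

Lemma size_block_words N :
  size (block_words N) = \prod_(i < N) 'C(k i.+1 - k i, x i.+1 - x i).
Proof.
elim: N => [|N IH]; first by rewrite big_ord0.
by rewrite big_ord_recr/= size_allpairs IH size_words.
Qed.

Lemma block_words_mem N w : size w = k N ->
  (forall i, i <= N -> count id (take (k i) w) = x i) -> w \in block_words N.
Proof.
elim: N w => [|N IH] w sw cw; first by move/eqP: sw; rewrite k0 size_eq0 => /eqP ->.
rewrite -(cat_take_drop (k N) w); apply: allpairs_f.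
  apply: IH => [|i iN]; first by rewrite size_takel// sw.
  rewrite take_takel; first by rewrite cw// leqW.
  exact: nat_homo_leq.
rewrite mem_words size_drop sw eqxx/=.
have := cw N.+1 (leqnn _); rewrite -sw take_size => wN.
have := cw N (leqnSn _) => wN'.
by rewrite -wN -wN' -{2}(cat_take_drop (k N) w) count_cat addKn.
Qed.

Hypothesis x_mono : forall i, x i <= x i.+1.

Lemma block_wordsP N w : w \in block_words N ->
  size w = k N /\ forall i, i <= N -> count id (take (k i) w) = x i.
Proof.
elim: N w => [|N IH] w /=.
  by rewrite inE => /eqP ->; split => // i; rewrite leqn0 => /eqP ->; rewrite x0.
move=> /allpairsP[[v u]/= [/IH[sv cv] + ->]].
rewrite mem_words => /andP[/eqP su /eqP cu].
split; first by rewrite size_cat sv su subnKC.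
move=> i; rewrite leq_eqVlt => /predU1P[->|].
  rewrite take_oversize ?size_cat ?sv ?su ?subnKC//.
  rewrite count_cat cu.
  by have := cv N (leqnn _); rewrite -sv take_size => ->; rewrite subnKC.
rewrite ltnS => iN; rewrite takel_cat ?cv// sv; exact: nat_homo_leq.
Qed.

Lemma block_words_uniq N : uniq (block_words N).
Proof.
elim: N => // N IH /=; apply: allpairs_uniq => //; first exact: words_uniq.
move=> [v w] [v' w'] /allpairsP[[a b]/= [/block_wordsP[sa _] _ [-> ->]]].
move=> /allpairsP[[a' b']/= [/block_wordsP[sa' _] _ [-> ->]]] E.
have aa : a = a' by rewrite -(take_size_cat b sa) E take_size_cat.
by move: E; rewrite aa => /eqP; rewrite eqseq_cat// eqxx/= => /eqP ->.
Qed.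

End block_words.

Section binomial_entropy.
Variable R : realType.

Lemma expR_xlnx (m : nat) : expR (m%:R * ln m%:R) = (m ^ m)%:R :> R.
Proof.
case: m => [|m]; first by rewrite mul0r expR0.
by rewrite expRM_natl lnK ?posrE// natrX.
Qed.

(** The exponential is the inverse of the probability that [l] independent letters,
    each [true] with probability [u / l], form a given word with [u] letters
    [true]. *)
Lemma entropy_pow l u : (0 < l)%N -> (u <= l)%N ->
  expR (l%:R * (ln 2 - J (2 * u%:R / l%:R - 1))) * ((u ^ u)%:R * ((l - u) ^ (l - u))%:R)
  = (l ^ l)%:R :> R.
Proof.
move=> l0 ul; have lr : 0 < l%:R :> R by rewrite ltr0n.
have ln_quot (m : nat) : m%:R * ln (2 * m%:R / l%:R) =
    m%:R * ln 2 + m%:R * ln m%:R - m%:R * ln l%:R :> R.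
  case: m => [|m]; first by rewrite !mul0r addr0 subr0.
  by rewrite ln_div ?posrE ?mulr_gt0// lnM ?posrE//; ring.
rewrite -!expR_xlnx -!expRD; congr expR.
rewrite /J.
have -> : 1 + (2 * u%:R / l%:R - 1) = 2 * u%:R / l%:R :> R by ring.
have -> : 1 - (2 * u%:R / l%:R - 1) = 2 * (l - u)%:R / l%:R :> R.
  by rewrite natrB//; field; rewrite gt_eqF.
have -> : l%:R * (ln 2 - (2^-1 * (2 * u%:R / l%:R * ln (2 * u%:R / l%:R)) +
    2^-1 * (2 * (l - u)%:R / l%:R * ln (2 * (l - u)%:R / l%:R)))) =
    l%:R * ln 2 - u%:R * ln (2 * u%:R / l%:R)
    - (l - u)%:R * ln (2 * (l - u)%:R / l%:R) :> R.
  by field; rewrite gt_eqF.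
rewrite !ln_quot natrB//; ring.
Qed.

Lemma binomial_le_entropy l u : (0 < l)%N -> (u <= l)%N ->
  'C(l, u)%:R <= expR (l%:R * (ln 2 - J (2 * u%:R / l%:R - 1))) :> R.
Proof.
move=> l0 ul; have pos m : (0 : R) < (m ^ m)%:R.
  by rewrite ltr0n expn_gt0; case: m.
rewrite -(ler_pM2r (mulr_gt0 (pos u) (pos (l - u)%N))) entropy_pow//.
by rewrite -!natrM ler_nat binomial_le_pow.
Qed.

Lemma entropy_le_binomial l u : (0 < l)%N -> (u <= l)%N ->
  expR (l%:R * (ln 2 - J (2 * u%:R / l%:R - 1))) <= l.+1%:R * 'C(l, u)%:R :> R.
Proof.
move=> l0 ul; have pos m : (0 : R) < (m ^ m)%:R.
  by rewrite ltr0n expn_gt0; case: m.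
rewrite -(ler_pM2r (mulr_gt0 (pos u) (pos (l - u)%N))) entropy_pow//.
by rewrite -mulrA -!natrM ler_nat pow_le_binomial.
Qed.

Variable k : nat -> nat.
Hypotheses (k0 : k 0%N = 0%N) (k_lt : forall i, (k i < k i.+1)%N).

(** The exponential cost of prescribing the number [x i] of letters [true] among
    the first [k i], for each [i <= N]. *)
Definition blocks_rate (x : nat -> nat) N : R :=
  \sum_(i < N) (k i.+1 - k i)%:R *
     J (2 * (x i.+1 - x i)%:R / (k i.+1 - k i)%:R - 1).

Let sum_len N : \sum_(i < N) ((k i.+1 - k i)%:R : R) = (k N)%:R.
Proof.
elim: N => [|N IH]; first by rewrite big_ord0 k0.
by rewrite big_ord_recr/= IH -natrD subnKC// ltnW.
Qed.

Let expR_blocks x N :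
  expR ((k N)%:R * ln 2 - blocks_rate x N) = \prod_(i < N)
    expR ((k i.+1 - k i)%:R *
      (ln 2 - J (2 * (x i.+1 - x i)%:R / (k i.+1 - k i)%:R - 1))).
Proof.
rewrite -expR_sum; congr expR; rewrite -sum_len mulr_suml -sumrB.
by apply: eq_bigr => i _; rewrite mulrBr.
Qed.

Lemma size_block_words_le x N :
    (forall i, (i < N)%N -> (x i.+1 - x i <= k i.+1 - k i)%N) ->
  (size (block_words k x N))%:R <= expR ((k N)%:R * ln 2 - blocks_rate x N).
Proof.
move=> xk; rewrite size_block_words natr_prod expR_blocks.
apply: ler_prod => i _; rewrite ler0n/= binomial_le_entropy//; last exact: xk.
by rewrite subn_gt0.
Qed.

Lemma size_block_words_ge x N :
    (forall i, (i < N)%N -> (x i.+1 - x i <= k i.+1 - k i)%N) ->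
  expR ((k N)%:R * ln 2 - blocks_rate x N) <=
  (k N).+1%:R ^+ N * (size (block_words k x N))%:R.
Proof.
move=> xk; rewrite size_block_words natr_prod expR_blocks.
have -> : (k N).+1%:R ^+ N = \prod_(i < N) (k N).+1%:R :> R.
  by rewrite prodr_const card_ord.
rewrite -big_split/=; apply: ler_prod => i _; rewrite expR_ge0/=.
apply: le_trans (entropy_le_binomial _ _) _; [by rewrite subn_gt0|exact: xk|].
rewrite ler_wpM2r// ler_nat ltnS.
have kN : (k i.+1 <= k N)%N by apply: nat_homo_leq => // j; exact: ltnW.
exact: leq_trans (leq_subr _ _) kN.
Qed.

(** The words are sorted by the numbers of letters [true] before the times [k i];
    there are polynomially many classes, each of controlled size. *)
Lemma count_words_rate_ge (W : seq bitseq) N (b : R) : uniq W ->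
    (forall w, w \in W -> size w = k N /\
       b <= blocks_rate (fun i => count id (take (k i) w)) N) ->
  (size W)%:R <= (k N).+1%:R ^+ N.+1 * expR ((k N)%:R * ln 2 - b).
Proof.
move=> uW HW; pose X w i := count id (take (k i) w).
pose cls (w : bitseq) : {ffun 'I_N.+1 -> 'I_(k N).+1} :=
  [ffun i : 'I_N.+1 => inord (X w i)].
have class_size c : (\sum_(w <- W | cls w == c) 1)%N%:R <= expR ((k N)%:R * ln 2 - b) :> R.
  rewrite sum1_count -size_filter.
  case Wc: [seq w <- W | cls w == c] => [|w0 Wc'] /=; first exact: expR_ge0.
  have : w0 \in [seq w <- W | cls w == c] by rewrite Wc mem_head.
  rewrite mem_filter => /andP[/eqP cw0 w0W]; have [sw0 bw0] := HW _ w0W.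
  have Xle i : (i < N)%N -> (X w0 i.+1 - X w0 i <= k i.+1 - k i)%N.
    move=> iN; rewrite /X leq_subLR -{1}(subnKC (ltnW (k_lt i))) takeD count_cat.
    rewrite leq_add2l (leq_trans (count_size _ _))//.
    by rewrite size_take; case: ltnP.
  rewrite -/(size (w0 :: Wc')) -Wc.
  apply: (@le_trans _ _ (size (block_words k (X w0) N))%:R); last first.
    by apply: le_trans (size_block_words_le Xle) _; rewrite ler_expR lerD2l lerN2.
  rewrite ler_nat; apply: uniq_leq_size; first exact: filter_uniq.
  move=> w; rewrite mem_filter => /andP[/eqP cw wW]; have [sw _] := HW _ wW.
  apply: block_words_mem => // [i|i iN]; first exact: ltnW.
  have Xlt v : size v = k N -> (X v i < (k N).+1)%N.
    by move=> sv; rewrite ltnS -sv (leq_trans (count_size _ _))// size_take; case: ltnP => // /ltnW.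
  have := congr1 (fun c : {ffun 'I_N.+1 -> 'I_(k N).+1} => c (inord i) : nat) (etrans cw (esym cw0)).
  by rewrite !ffunE !inordK ?Xlt// ltnS.
rewrite -sum1_size (partition_big cls xpredT)//= natr_sum.
apply: (@le_trans _ _ (\sum_(c : {ffun 'I_N.+1 -> 'I_(k N).+1}) expR ((k N)%:R * ln 2 - b))).
  by apply: ler_sum => c _; exact: class_size.
by rewrite sumr_const card_ffun !card_ord -[leLHS]mulr_natl natrX.
Qed.

End binomial_entropy.

(** * An upper bound for the number of avoiders of large rate *)

Section block_times.
Variable R : realType.

Definition block_time (n N i : nat) : nat := (n * i) %/ N.

Lemma block_time0 n N : block_time n N 0 = 0%N.
Proof. by rewrite /block_time muln0 div0n. Qed.

Lemma block_timeN n N : (0 < N)%N -> block_time n N N = n.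
Proof. exact: mulnK. Qed.

Lemma block_time_bounds n N i : (0 < N)%N -> (0 < n)%N ->
  i%:R / N%:R - n%:R^-1 <= ((block_time n N i)%:R / n%:R : R) <= i%:R / N%:R.
Proof.
move=> N0 n0; have Nr : 0 < N%:R :> R by rewrite ltr0n.
have nr : 0 < n%:R :> R by rewrite ltr0n.
apply/andP; split.
  rewrite lerBlDr -[X in _ + X]mul1r -mulrDl ler_pdivrMr// mulrAC ler_pdivlMr//.
  by rewrite natr1 -!natrM ler_nat [leqLHS]mulnC ltnW// ltn_ceil.
by rewrite ler_pdivrMr// mulrAC ler_pdivlMr// -!natrM ler_nat [leqRHS]mulnC leq_divM.
Qed.

Lemma block_time_lt n N i : (0 < N)%N -> (N <= n)%N ->
  (block_time n N i < block_time n N i.+1)%N.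
Proof.
move=> N0 Nn; rewrite /block_time mulnS addnC.
apply: (@leq_trans ((n * i + N) %/ N)); first by rewrite divnDr ?dvdnn// divnn N0 addn1.
by apply: leq_div2r; rewrite leq_add2l.
Qed.

(** For large [n], the rate of a discretized curve hardly depends on the grid,
    on the rounding, or on the curve. *)
Lemma discretized_rate_close N (e : R) : (0 < N)%N -> 0 < e ->
  exists n0, forall n, (n0 <= n)%N -> forall (psi : R -> R) (v : nat -> R),
    (forall x y, `|psi x - psi y| <= `|x - y|) ->
    let A i := (block_time n N i.+1 - block_time n N i)%:R / n%:R in
    (forall i, (i <= N)%N -> `|v i - psi ((block_time n N i)%:R / n%:R)| <= n%:R^-1) ->
    (forall i, (i < N)%N -> `|v i.+1 - v i| <= A i) ->
  `|\sum_(i < N) 2 * A i * J ((v i.+1 - v i) / A i) - discrete_rate N psi| <= e.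
Proof.
move=> N0 e0; have Nr : 0 < N%:R :> R by rewrite ltr0n.
have [d d0 Jd] := J_unif_continuous (divr_gt0 e0 (ltr0n R 4)).
exists (maxn N (maxn (Num.trunc (5 * N%:R / d)).+1 (Num.trunc (4 * N%:R / e)).+1)).
move=> n; rewrite !geq_max => /and3P[Nn nd ne] psi v lip A vpsi vA.
have n_gt0 : (0 < n)%N by exact: leq_trans Nn.
have nr : 0 < n%:R :> R by rewrite ltr0n.
have {}nd : 5 * N%:R / n%:R <= d.
  rewrite ler_pdivrMr// [leRHS]mulrC -ler_pdivrMr// ltW//.
  by apply: lt_le_trans (Num.Theory.truncnS_gt _) _; rewrite ler_nat.
have {}ne : 2 * N%:R / n%:R <= e / 2.
  rewrite ler_pdivrMr//; have : 4 * N%:R / e < n%:R.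
    by apply: lt_le_trans (Num.Theory.truncnS_gt _) _; rewrite ler_nat.
  by rewrite ltr_pdivrMr//; nra.
have bt i := block_time_bounds i N0 n_gt0.
have AE i : A i = (block_time n N i.+1)%:R / n%:R - (block_time n N i)%:R / n%:R.
  by rewrite /A natrB ?mulrBl// ltnW// block_time_lt.
have A0 i : 0 < A i by rewrite /A divr_gt0// ltr0n subn_gt0 block_time_lt.
have A_close i : `|A i - N%:R^-1| <= n%:R^-1.
  have /andP[? ?] := bt i; have /andP[? ?] := bt i.+1.
  have := block_len R i N0; rewrite AE ler_norml => ?; apply/andP; split; lra.
have psi_close i : (i <= N)%N -> `|v i - psi (i%:R / N%:R)| <= 2 * n%:R^-1.
  move=> iN; have := vpsi i iN; have /andP[? ?] := bt i.
  have := lip ((block_time n N i)%:R / n%:R) (i%:R / N%:R).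
  rewrite [X in _ <= X]ler0_norm ?subr_le0// => h1 h2.
  have := ler_normD (v i - psi ((block_time n N i)%:R / n%:R))
    (psi ((block_time n N i)%:R / n%:R) - psi (i%:R / N%:R)).
  by rewrite addrA subrK => /le_trans; apply; lra.
rewrite /discrete_rate mulr_sumr.
apply: le_trans (@sum_J_close R N (fun i => 2 * A i) (fun=> 2 / N%:R)
  (fun i => (v i.+1 - v i) / A i)
  (fun i => N%:R * (psi (i.+1%:R / N%:R) - psi (i%:R / N%:R))) d (e / 4) Jd _) _.
  move=> i iN; split.
  - by rewrite divr_ge0.
  - by rewrite normrM normfV (gtr0_norm (A0 i)) ler_pdivrMr// mul1r vA.
  - rewrite normrM gtr0_norm// -ler_pdivlMl// mulr1 (le_trans (lip _ _))//.
    by rewrite block_len// gtr0_norm ?invr_gt0.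
  have -> : (v i.+1 - v i) / A i - N%:R * (psi (i.+1%:R / N%:R) - psi (i%:R / N%:R)) =
      (v i.+1 - v i) / A i * (N%:R * (N%:R^-1 - A i)) +
      N%:R * ((v i.+1 - psi (i.+1%:R / N%:R)) - (v i - psi (i%:R / N%:R))).
    by field; rewrite !gt_eqF.
  apply: le_trans nd; apply: le_trans (ler_normD _ _) _.
  have -> : 5 * N%:R / n%:R = N%:R * n%:R^-1 + N%:R * (4 * n%:R^-1) :> R by ring.
  apply: lerD; rewrite normrM.
    rewrite -[leRHS]mul1r ler_pM//.
      by rewrite normrM normfV (gtr0_norm (A0 i)) ler_pdivrMr// mul1r vA.
    by rewrite normrM gtr0_norm// ler_pM2l// distrC.
  rewrite gtr0_norm// ler_pM2l// (le_trans (ler_normB _ _))//.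
  by have := psi_close i.+1 iN; have := psi_close i (ltnW iN); lra.
apply: (@le_trans _ _ (\sum_(i < N) (2 / N%:R * (e / 4) + 2 * n%:R^-1))).
  apply: ler_sum => i _; rewrite lerD2l -mulrBr normrM (gtr0_norm (ltr0n R 2)).
  by rewrite ler_pM2l.
rewrite sumr_const card_ord -[leLHS]mulr_natr.
have -> : (2 / N%:R * (e / 4) + 2 / n%:R) * N%:R = e / 2 + 2 * N%:R / n%:R.
  by field; rewrite !gt_eqF.
lra.
Qed.

Lemma blocks_rate_discretized n N (x : nat -> nat) : (0 < N)%N -> (N <= n)%N ->
    (forall i, (i < N)%N -> (x i <= x i.+1)%N) ->
    let A i := (block_time n N i.+1 - block_time n N i)%:R / n%:R : R in
    let v i := ((x i)%:R - (block_time n N i)%:R) / n%:R : R in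
  blocks_rate R (fun i => (block_time n N i).*2) x N =
  n%:R * \sum_(i < N) 2 * A i * J ((v i.+1 - v i) / A i).
Proof.
move=> N0 Nn xm A v; have nr : 0 < n%:R :> R by rewrite ltr0n (leq_trans N0).
rewrite /blocks_rate mulr_sumr; apply: eq_bigr => i _.
have blt := block_time_lt i N0 Nn.
have b0 : 0 < (block_time n N i.+1)%:R - (block_time n N i)%:R :> R.
  by rewrite subr_gt0 ltr_nat.
rewrite /A /v -doubleB -mul2n natrM !natrB ?xm//; last exact: ltnW.
set dt := (block_time n N i.+1)%:R - (block_time n N i)%:R in b0 *.
have -> : 2 * ((x i.+1)%:R - (x i)%:R) / (2 * dt) - 1 =
  (((x i.+1)%:R - (block_time n N i.+1)%:R) / n%:R -
   ((x i)%:R - (block_time n N i)%:R) / n%:R) / (dt / n%:R) :> R.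
  by rewrite /dt in b0 *; field; rewrite !gt_eqF.
by field; rewrite gt_eqF.
Qed.

End block_times.

Section counting_bounds.
Variable R : realType.

(** The words of distinct avoiders are distinct, and the rate of a curve is close
    to the rate of its word. *)
Lemma count_avoiders_rate_ge N (b e : R) : (0 < N)%N -> 0 < e ->
  exists n0, forall n, (n0 <= n)%N -> forall S : seq 'S_n, uniq S ->
    (forall s, s \in S -> avoids231 s /\ b <= discrete_rate N (rotated_curve R s)) ->
  (size S)%:R <= (n.*2).+1%:R ^+ N.+1 * expR (n%:R * (2 * ln 2 - b + e)).
Proof.
move=> N0 e0; have [n0 n0P] := discretized_rate_close N0 e0.
exists (maxn n0 N) => n; rewrite geq_max => /andP[n0n Nn] S uS HS.
have n_gt0 : (0 < n)%N by exact: leq_trans Nn.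
have nr : 0 < n%:R :> R by rewrite ltr0n.
pose k i := (block_time n N i).*2.
have kN : k N = n.*2 by rewrite /k block_timeN.
have k_lt i : (k i < k i.+1)%N by rewrite /k ltn_double block_time_lt.
have k0 : k 0%N = 0%N by rewrite /k block_time0.
have -> : n%:R * (2 * ln 2 - b + e) = (k N)%:R * ln 2 - n%:R * (b - e).
  by rewrite kN -mul2n natrM; ring.
rewrite -kN -(size_map (@rlm_word n)).
apply: count_words_rate_ge => //.
  by rewrite map_inj_in_uniq// => s t /HS[avs _] /HS[avt _]; exact: rlm_word_inj.
move=> _ /mapP[s sS ->]; have [avs bs] := HS s sS.
rewrite size_rlm_word kN; split => //.
have k_le i : (i <= N)%N -> (k i <= n.*2)%N.
  by rewrite -kN => iN; apply: nat_homo_leq iN => j; exact: ltnW.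
have xE i : (i <= N)%N -> count id (take (k i) (rlm_word s)) = east_steps s (k i).
  by move=> iN; rewrite count_rlm_word// k_le.
rewrite (@blocks_rate_discretized R n N)//; last first.
  by move=> i iN; rewrite -/(k _) -/(k _) !xE ?(ltnW iN)// east_steps_mono// ltnW.
rewrite ler_pM2l//.
pose v i : R := ((count id (take (k i) (rlm_word s)))%:R - (block_time n N i)%:R) / n%:R.
have vE i : (i <= N)%N -> v i = rotated_curve R s ((block_time n N i)%:R / n%:R).
  move=> iN; rewrite /v -/(k i) xE//.
  have -> : (block_time n N i)%:R / n%:R = (k i)%:R / (2 * n%:R) :> R.
    by rewrite /k -mul2n natrM; field; rewrite gt_eqF.
  rewrite rotated_curve_lattice ?k_le// /k -mul2n natrM.
  by field; rewrite gt_eqF.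
have := n0P n n0n (rotated_curve R s) v (@excursion_lipschitz _ _).
move=> /(_ _)/wrap[] => [i iN|].
  by rewrite vE// subrr normr0 invr_ge0.
move=> /(_ _)/wrap[] => [i iN|].
  rewrite !vE ?(ltnW iN)// (le_trans (excursion_lipschitz _ _ _))//.
  rewrite -mulrBl -natrB; last by rewrite ltnW// block_time_lt.
  by rewrite ger0_norm// divr_ge0.
have close (u w : R) : `|u - w| <= e -> b <= w -> b - e <= u.
  by rewrite ler_norml => /andP[]; lra.
by move=> h; exact: close h bs.
Qed.

End counting_bounds.

(** * A lower bound for the number of avoiders close to an excursion *)

Section truncated_target.
Variable R : realType.
Variables (phi : excursion R) (dl : R).
Hypotheses (dl0 : 0 <= dl).

(** The excursion is raised where it is low, so that every path close to the
    result on a grid is nonnegative between the points of the grid: the result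
    leaves 0 and returns to 0 at full speed, and meanwhile stays at height at
    least [dl]. *)
Definition lifted (t : R) : R := Num.max (phi t) (Num.min dl (Num.min t (1 - t))).

Lemma lipschitz1_min (f g : R -> R) :
  (forall x y, `|f x - f y| <= `|x - y|) -> (forall x y, `|g x - g y| <= `|x - y|) ->
  forall x y, `|Num.min (f x) (g x) - Num.min (f y) (g y)| <= `|x - y|.
Proof.
move=> lf lg x y; have := lf x y; have := lg x y.
rewrite !ler_norml => /andP[? ?] /andP[? ?].
by case: (lerP (f x) (g x)) => ?; case: (lerP (f y) (g y)) => ?; apply/andP; split; lra.
Qed.

Lemma lipschitz1_max (f g : R -> R) :
  (forall x y, `|f x - f y| <= `|x - y|) -> (forall x y, `|g x - g y| <= `|x - y|) ->
  forall x y, `|Num.max (f x) (g x) - Num.max (f y) (g y)| <= `|x - y|.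
Proof.
move=> lf lg x y; have := lf x y; have := lg x y.
rewrite !ler_norml => /andP[? ?] /andP[? ?].
by case: (lerP (f x) (g x)) => ?; case: (lerP (f y) (g y)) => ?; apply/andP; split; lra.
Qed.

Lemma lifted_lipschitz x y : `|lifted x - lifted y| <= `|x - y|.
Proof.
apply: (@lipschitz1_max phi (fun t => Num.min dl (Num.min t (1 - t)))) => [|s t].
  exact: excursion_lipschitz.
apply: (@lipschitz1_min (fun=> dl) (fun t => Num.min t (1 - t))) => [u v|u v].
  by rewrite subrr normr0.
apply: (@lipschitz1_min id (fun t => 1 - t)) => // a b.
have -> : 1 - a - (1 - b) = - (a - b) by ring.
by rewrite normrN.
Qed.

Lemma lifted_ge_phi t : phi t <= lifted t.
Proof. by rewrite /lifted le_max lexx. Qed.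

Lemma lifted_ge0 t : 0 <= lifted t.
Proof. by apply: le_trans (lifted_ge_phi t); have /andP[] := excursion_le1 phi t. Qed.

Lemma lifted_ge_min t : Num.min dl (Num.min t (1 - t)) <= lifted t.
Proof. by rewrite /lifted le_max lexx orbT. Qed.

Lemma lifted_le t : lifted t <= phi t + dl.
Proof.
have /andP[p0 _] := excursion_le1 phi t.
rewrite /lifted ge_max lerDl dl0/=.
by rewrite ge_min lerDr p0.
Qed.

Lemma lifted_at0 : lifted 0 = 0.
Proof.
rewrite /lifted excursion_at0 (@min_l _ _ 0 (1 - 0)) ?subr0 ?ler01//.
by rewrite min_r// max_l.
Qed.

Lemma lifted_at1 : lifted 1 = 0.
Proof. by rewrite /lifted excursion_at1 subrr (@min_r _ _ 1 0)// min_r// max_l. Qed.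

Lemma lifted_middle t : dl <= t -> t <= 1 - dl -> lifted t = Num.max (phi t) dl.
Proof.
by move=> t0 t1; rewrite /lifted min_l// le_min t0/=; lra.
Qed.

End truncated_target.

Section lifted_rate.
Variable R : realType.

(** Truncating from below contracts the slopes, so only the four first and the
    four last blocks can cost more than those of [phi]. *)
Lemma lifted_rate_le (phi : excursion R) N : (8 <= N)%N ->
  discrete_rate N (lifted phi (4 / N%:R)) <= discrete_rate N phi + 16 / N%:R.
Proof.
move=> N8; have N0 : (0 < N)%N by exact: leq_trans N8.
have Nr : 0 < N%:R :> R by rewrite ltr0n.
set psi := lifted phi _.
have dl0 : 0 <= 4 / N%:R :> R by rewrite divr_ge0.
pose J1 (f : R -> R) i : R := J (N%:R * (f (i.+1%:R / N%:R) - f (i%:R / N%:R))).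
have step i : (i < N)%N -> J1 psi i <= J1 phi i + ((i < 4)%N%:R + (~~ (i < N - 4)%N)%:R).
  move=> iN; have [i4|i4] := ltnP i 4.
    have h : J1 psi i <= 1.
      apply: le_trans (ln2_le1 R); apply: J_le_ln2.
      rewrite normrM gtr0_norm// -ler_pdivlMl// mulr1 (le_trans (lifted_lipschitz _ _ _ _))//.
      by rewrite block_len// gtr0_norm ?invr_gt0.
    by have := J_ge0 (N%:R * (phi (i.+1%:R / N%:R) - phi (i%:R / N%:R))); 
      rewrite -/(J1 _ _) /=; case: (~~ _) => /=; lra.
  have [iN4|iN4] := ltnP i (N - 4); last first.
    have h : J1 psi i <= 1.
      apply: le_trans (ln2_le1 R); apply: J_le_ln2.
      rewrite normrM gtr0_norm// -ler_pdivlMl// mulr1 (le_trans (lifted_lipschitz _ _ _ _))//.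
      by rewrite block_len// gtr0_norm ?invr_gt0.
    by have := J_ge0 (N%:R * (phi (i.+1%:R / N%:R) - phi (i%:R / N%:R)));
      rewrite -/(J1 _ _) /=; lra.
  rewrite /= !addr0; apply: J_le_norm; last exact: grid_slope_le1.
  have mid j : (4 <= j)%N -> (j <= N - 4)%N ->
      psi (j%:R / N%:R) = Num.max (phi (j%:R / N%:R)) (4 / N%:R).
    move=> j4 jN; apply: lifted_middle; first by rewrite ler_pM2r ?invr_gt0// ler_nat.
    have -> : 1 - 4 / N%:R = (N - 4)%N%:R / N%:R :> R.
      by rewrite natrB; [field; rewrite gt_eqF|lia].
    by rewrite ler_pM2r ?invr_gt0// ler_nat.
  rewrite !mid//; try lia.
  rewrite !normrM ler_pM2l ?normr_gt0 ?gt_eqF//.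
  set u := phi _; set v := phi _; set c := 4 / _.
  case: (lerP u c) => ?; case: (lerP v c) => ?; rewrite ?subrr ?normr0//.
  - by rewrite ler0_norm ?ler0_norm; lra.
  - by rewrite ger0_norm ?ger0_norm; lra.
rewrite /discrete_rate.
have -> : 16 / N%:R = 2 / N%:R * 8 :> R by ring.
rewrite -mulrDr ler_pM2l ?divr_gt0//.
apply: (@le_trans _ _ (\sum_(i < N) (J1 phi i + ((i < 4)%N%:R + (~~ (i < N - 4)%N)%:R)))).
  by apply: ler_sum => i _; exact: step.
rewrite big_split/= lerD2l big_split/= -!natr_sum -natrD ler_nat.
rewrite sum_lt_ord; last by lia.
have below := @sum_lt_ord N (N - 4) (leq_subr _ _).
have total : (\sum_(i < N) (i < N - 4) + \sum_(i < N) ~~ (i < N - 4) = N)%N.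
  rewrite -big_split/= (eq_bigr (fun=> 1%N)) ?sum_nat_const ?card_ord ?muln1//.
  by move=> i _; case: (_ < _)%N.
rewrite below in total; rewrite -(leq_add2l (N - 4)) addnCA total.
by clear -N8; lia.
Qed.

End lifted_rate.

Section target_words.
Variables (R : realType) (phi : excursion R) (n N : nat).
Hypotheses (N8 : (8 <= N)%N) (Nn : (N <= n)%N).

Let N0 : (0 < N)%N. Proof. exact: leq_trans N8. Qed.
Let n0 : (0 < n)%N. Proof. exact: leq_trans Nn. Qed.
Let Nr : 0 < N%:R :> R. Proof. by rewrite ltr0n. Qed.
Let nr : 0 < n%:R :> R. Proof. by rewrite ltr0n. Qed.
Let dl : R := 4 / N%:R.
Let dl0 : 0 <= dl. Proof. by rewrite divr_ge0. Qed.
Let psi := lifted phi dl.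
Let a i := block_time n N i.
Let k i := (a i).*2.

(** Half the height at time [k i] of the paths to be counted, and their number
    of East steps before that time. *)
Definition target_height (i : nat) : nat := Num.trunc (n%:R * psi ((a i)%:R / n%:R)).
Definition target_east (i : nat) : nat := (a i + target_height i)%N.

Let G := target_height.
Let x := target_east.

Let aS i : (a i < a i.+1)%N. Proof. exact: block_time_lt. Qed.
Let aR i : n%:R * ((a i)%:R / n%:R) = (a i)%:R :> R.
Proof. by rewrite mulrC divfK// gt_eqF. Qed.

Let psi_ge0 i : 0 <= n%:R * psi ((a i)%:R / n%:R).
Proof. by rewrite mulr_ge0// lifted_ge0. Qed.

Let GP i : (G i)%:R <= n%:R * psi ((a i)%:R / n%:R) < (G i).+1%:R.
Proof. exact: Num.Theory.truncn_itv. Qed.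

Lemma target_height_close i : `|(G i)%:R / n%:R - psi ((a i)%:R / n%:R)| <= n%:R^-1.
Proof.
have /andP[h1 h2] := GP i; rewrite -natr1 in h2.
have -> : (G i)%:R / n%:R - psi ((a i)%:R / n%:R) =
    - ((n%:R * psi ((a i)%:R / n%:R) - (G i)%:R) / n%:R).
  by field; rewrite gt_eqF.
rewrite normrN normrM normfV (gtr0_norm nr) -[leRHS]mul1r ler_pM2r ?invr_gt0//.
by rewrite ger0_norm; lra.
Qed.

Lemma target_height_step i :
  (G i.+1 <= G i + (a i.+1 - a i))%N /\ (G i <= G i.+1 + (a i.+1 - a i))%N.
Proof.
have trunc_le (u v : R) m : 0 <= u -> 0 <= v -> v <= u + m%:R ->
    (Num.trunc v <= Num.trunc u + m)%N.
  move=> u0 v0 vu; rewrite -ltnS Num.Theory.truncn_lt_nat// -addSn natrD.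
  apply: le_lt_trans vu _; rewrite ltrD2r; exact: Num.Theory.truncnS_gt.
have := lifted_lipschitz phi dl ((a i.+1)%:R / n%:R) ((a i)%:R / n%:R).
rewrite -mulrBl -natrB ?(ltnW (aS i))// [X in _ <= X]ger0_norm ?divr_ge0// ler_norml.
rewrite ler_pdivlMr// -mulNr ler_pdivrMr// => /andP[h1 h2].
by split; apply: trunc_le => //; rewrite -/psi in h1 h2; lra.
Qed.

Lemma target_east0 : x 0%N = 0%N.
Proof.
rewrite /x /target_east /target_height /a block_time0 mul0r /psi lifted_at0//.
by rewrite mulr0 Num.Theory.truncn0.
Qed.

Lemma target_eastN : x N = n.
Proof.
rewrite /x /target_east /target_height /a block_timeN// divff ?gt_eqF// /psi lifted_at1//.
by rewrite mulr0 Num.Theory.truncn0 addn0.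
Qed.

Lemma target_east_mono i : (x i <= x i.+1)%N.
Proof. by have [_] := target_height_step i; have := aS i; rewrite /x /target_east -/(G _) -/(G _); lia. Qed.

Lemma target_east_le i : (x i.+1 - x i <= k i.+1 - k i)%N.
Proof.
by have [+ _] := target_height_step i; have := aS i;
  rewrite /x /target_east -/(G _) -/(G _) /k; lia.
Qed.

Let k0 : k 0%N = 0%N. Proof. by rewrite /k /a block_time0. Qed.
Let kN : k N = n.*2. Proof. by rewrite /k /a block_timeN. Qed.
Let kS i : (k i < k i.+1)%N. Proof. by rewrite /k ltn_double. Qed.

(** Inside a block the path cannot leave the height of one of its ends by more
    than the time to that end. *)
Lemma target_height_cases i : (i < N)%N ->
  [\/ (a i.+1 <= G i.+1)%N, (n - a i <= G i)%N | (a i.+1 - a i <= G i)%N].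
Proof.
move=> iN.
have Gge m j : m%:R <= n%:R * psi ((a j)%:R / n%:R) -> (m <= G j)%N.
  by move=> h; rewrite /G /target_height Num.Theory.truncn_ge_nat.
have psi_min j : n%:R * psi ((a j)%:R / n%:R) >=
    n%:R * Num.min dl (Num.min ((a j)%:R / n%:R) (1 - (a j)%:R / n%:R)).
  by rewrite ler_pM2l// lifted_ge_min.
have /andP[l1 u1] := block_time_bounds R i.+1 N0 n0.
have /andP[l0 u0] := block_time_bounds R i N0 n0.
rewrite -!/(a _) in l1 u1 l0 u0.
have len := block_len R i N0.
have nN : n%:R^-1 <= N%:R^-1 :> R by rewrite lef_pV2 ?posrE// ler_nat.
have N8R : N%:R^-1 * 8 <= 1 :> R by rewrite mulrC ler_pdivrMr// mul1r ler_nat.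
have dlE : dl = 4 * N%:R^-1 by [].
have Ni0 : 0 < N%:R^-1 :> R by rewrite invr_gt0.
have [s1|s1] := leP ((a i.+1)%:R / n%:R) dl.
  apply: Or31; apply: Gge; apply: le_trans (psi_min _).
  rewrite min_r; last by rewrite ge_min s1.
  by rewrite min_l ?aR//; lra.
have [s0|s0] := leP (1 - dl) ((a i)%:R / n%:R).
  apply: Or32; apply: Gge; apply: le_trans (psi_min _).
  have an : (a i <= n)%N.
    by rewrite -(ler_nat R) -(ler_pM2r (x := n%:R^-1)) ?invr_gt0// divff ?gt_eqF//; 
      apply: le_trans u0 _; rewrite ler_pdivrMr// mul1r ler_nat ltnW.
  rewrite min_r; last by rewrite ge_min; apply/orP; right; lra.
  rewrite min_r; last lra.
  by rewrite mulrBr mulr1 aR natrB.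
apply: Or33; apply: Gge; apply: le_trans (psi_min _).
rewrite natrB ?(ltnW (aS i))// -[X in X - _ <= _]aR -[X in _ - X <= _]aR.
rewrite -mulrBr ler_pM2l// !le_min.
by apply/and3P; split; lra.
Qed.

Lemma target_words_dyck w : w \in block_words k x N ->
  [/\ size w = n.*2, count id w = n &
      forall j, (j <= n.*2)%N -> (j <= (count id (take j w)).*2)%N].
Proof.
move=> /(block_wordsP k0 target_east0 (fun i => ltnW (kS i)) target_east_mono)[sw cw].
rewrite kN in sw; have cwN : count id w = n.
  by have := cw N (leqnn _); rewrite kN -sw take_size target_eastN.
split => // j; rewrite leq_eqVlt => /predU1P[->|jn].
  by rewrite -[in take _ _]sw take_size cwN.
have [i iN /andP[ij ji]] : exists2 i, (i < N)%N & (k i <= j < k i.+1)%N.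
  have ex : exists i, (j < k i)%N by exists N; rewrite kN.
  case: (ex_minnP ex) => -[|i]; first by rewrite k0.
  move=> jk imin; exists i; first by rewrite -ltnS; apply: imin; rewrite kN.
  by rewrite jk andbT leqNgt; apply/negP => /imin; rewrite ltnn.
have c0 := cw i (ltnW iN); have c1 := cw i.+1 iN.
have j0 : (count id (take (k i) w) <= count id (take j w))%N.
  by rewrite -(subnKC ij) takeD count_cat leq_addr.
have j1 : (count id (take (k i.+1) w) <= count id (take j w) + (k i.+1 - j))%N.
  rewrite -{1}(subnKC (ltnW ji)) takeD count_cat leq_add2l.
  by rewrite (leq_trans (count_size _ _))// size_take; case: ltnP.
rewrite c0 in j0; rewrite c1 in j1; clear c0 c1.
move: j0 j1 ij ji; set X := count id _.
rewrite /x /target_east -!/(G _) /k.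
have an : (a i <= n)%N.
  by have := kN; rewrite /k => /double_inj <-; apply: nat_homo_leq (ltnW iN) => ?; exact: ltnW.
have := aS i; case: (target_height_cases iN); lia.
Qed.

Lemma target_curve_close (s : 'S_n) : rlm_word s \in block_words k x N ->
  sup_dist (rotated_curve R s) phi <= 9 / N%:R.
Proof.
move=> sw; have [_ cw] := block_wordsP k0 target_east0 (fun i => ltnW (kS i)) target_east_mono sw.
have k_le i : (i <= N)%N -> (k i <= n.*2)%N.
  by rewrite -kN => iN; apply: nat_homo_leq iN => j; exact: ltnW.
have nN : n%:R^-1 <= N%:R^-1 :> R by rewrite lef_pV2 ?posrE// ler_nat.
have at_a i : (i <= N)%N ->
    `|rotated_curve R s ((a i)%:R / n%:R) - phi ((a i)%:R / n%:R)| <= 5 / N%:R.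
  move=> iN.
  have -> : rotated_curve R s ((a i)%:R / n%:R) = (G i)%:R / n%:R.
    have -> : (a i)%:R / n%:R = (k i)%:R / (2 * n%:R) :> R.
      by rewrite /k -mul2n natrM; field; rewrite gt_eqF.
    rewrite rotated_curve_lattice ?k_le// -count_rlm_word ?k_le// cw//.
    rewrite /x /target_east -/(G i) natrD /k -mul2n natrM.
    by field; rewrite gt_eqF.
  have h1 := target_height_close i.
  have h2 := lifted_ge_phi phi dl ((a i)%:R / n%:R).
  have h3 := lifted_le phi dl0 ((a i)%:R / n%:R).
  have dlE : 5 / N%:R = dl + N%:R^-1 by rewrite /dl; ring.
  rewrite dlE; move: h1 h2 h3; rewrite -/psi !ler_norml => /andP[? ?] ? ?.
  by apply/andP; split; lra.
apply: excursion_sup_dist_le => t t0 t1.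
have tN0 : 0 <= t * N%:R by rewrite mulr_ge0.
set i := Num.trunc (t * N%:R).
have iN : (i <= N)%N.
  by rewrite /i -ltnS Num.Theory.truncn_lt_nat// (@le_lt_trans _ _ N%:R) ?ltr_nat// ler_piMl.
have /andP[it ti] := Num.Theory.truncn_itv tN0; rewrite -/i in it ti.
have /andP[l0 u0] := block_time_bounds R i N0 n0; rewrite -/(a i) in l0 u0.
have ta : `|t - (a i)%:R / n%:R| <= 2 / N%:R.
  have h1 : i%:R / N%:R <= t by rewrite ler_pdivrMr.
  have h2 : t <= i%:R / N%:R + N%:R^-1.
    by rewrite -[X in _ + X]mul1r -mulrDl natr1 ler_pdivlMr// ltW.
  by rewrite ger0_norm; lra.
have h1 := excursion_lipschitz (rotated_curve R s) t ((a i)%:R / n%:R).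
have h2 := excursion_lipschitz phi ((a i)%:R / n%:R) t.
rewrite [X in _ <= X]distrC in h2.
have h3 := at_a i iN.
have -> : rotated_curve R s t - phi t =
  (rotated_curve R s t - rotated_curve R s ((a i)%:R / n%:R)) +
  (rotated_curve R s ((a i)%:R / n%:R) - phi ((a i)%:R / n%:R)) +
  (phi ((a i)%:R / n%:R) - phi t) by ring.
apply: le_trans (ler_normD _ _) _.
have -> : 9 / N%:R = 2 / N%:R + 5 / N%:R + 2 / N%:R :> R by ring.
apply: lerD; last exact: le_trans h2 ta.
by apply: le_trans (ler_normD _ _) _; apply: lerD => //; exact: le_trans h1 ta.
Qed.

Lemma count_target_avoiders : exists S : seq 'S_n, [/\ uniq S,
  forall s, s \in S -> avoids231 s /\ sup_dist (rotated_curve R s) phi <= 9 / N%:R &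
  (size (block_words k x N) <= size S)%N].
Proof.
exists [seq s <- enum 'S_n | avoids231 s && (rlm_word s \in block_words k x N)].
split; first by rewrite filter_uniq// enum_uniq.
  move=> s; rewrite mem_filter => /andP[/andP[avs sw] _]; split => //.
  exact: target_curve_close.
rewrite -(size_map (@rlm_word n)); apply: uniq_leq_size.
  exact: (block_words_uniq k0 target_east0 (fun i => ltnW (kS i)) target_east_mono).
move=> w wB; have [sw cw dw] := target_words_dyck wB.
have [s avs sE] := rlm_word_surj sw cw dw.
by apply/mapP; exists s => //; rewrite mem_filter avs sE wB mem_enum.
Qed.

End target_words.

(** Each word with the contents [target_east] is the word of an avoider whose
    curve is close to [phi], and the rate of the target exceeds that of [phi] by
    a multiple of [1 / N] only. *)
Lemma count_avoiders_near (R : realType) (phi : excursion R) (h r e : R) :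
    0 < r -> 0 < e -> (forall N, (0 < N)%N -> discrete_rate N phi <= h) ->
  exists N n0, forall n, (n0 <= n)%N -> exists S : seq 'S_n,
    [/\ uniq S,
      forall s, s \in S -> avoids231 s /\ sup_dist (rotated_curve R s) phi < r &
      expR (n%:R * (2 * ln 2 - h - e)) <= (n.*2).+1%:R ^+ N * (size S)%:R].
Proof.
move=> r0 e0 hphi.
pose N := maxn 8 (maxn (Num.trunc (9 / r)).+1 (Num.trunc (32 / e)).+1).
have N8 : (8 <= N)%N by rewrite leq_max leqnn.
have N0 : (0 < N)%N by exact: leq_trans N8.
have Nr : 0 < N%:R :> R by rewrite ltr0n.
have rN : 9 / N%:R < r.
  rewrite ltr_pdivrMr// mulrC -ltr_pdivrMr//.
  apply: lt_le_trans (Num.Theory.truncnS_gt _) _; rewrite ler_nat.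
  by rewrite /N !leq_max leqnn !orbT.
have eN : 16 / N%:R <= e / 2.
  have : 32 / e < N%:R.
    apply: lt_le_trans (Num.Theory.truncnS_gt _) _; rewrite ler_nat.
    by rewrite /N !leq_max leqnn !orbT.
  by rewrite ltr_pdivrMr// ler_pdivrMr//; nra.
have e2 : 0 < e / 2 by rewrite divr_gt0.
have [n0 n0P] := discretized_rate_close N0 e2.
exists N, (maxn n0 N) => n; rewrite geq_max => /andP[n0n Nn].
have n_gt0 : (0 < n)%N by exact: leq_trans Nn.
have nr : 0 < n%:R :> R by rewrite ltr0n.
have [S [uS HS sS]] := count_target_avoiders phi N8 Nn.
exists S; split => // [s /HS[avs ds]|]; first by split => //; exact: le_lt_trans ds rN.
apply: (@le_trans _ _ ((n.*2).+1%:R ^+ N *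
  (size (block_words (fun i => (block_time n N i).*2) (target_east phi n N) N))%:R)); last first.
  by rewrite ler_wpM2l ?exprn_ge0// ler_nat.
have kN : (block_time n N N).*2 = n.*2 by rewrite block_timeN.
have := @size_block_words_ge R (fun i => (block_time n N i).*2) _ _ (target_east phi n N) N _.
rewrite kN => /(_ _ _ _)/wrap[].
- by rewrite block_time0.
- by move=> i; rewrite ltn_double block_time_lt.
- by move=> i _; exact: target_east_le.
apply: le_trans; rewrite ler_expR.
rewrite (@blocks_rate_discretized R n N)//; last by move=> i _; exact: target_east_mono.
rewrite -mul2n natrM.
set Sg := \sum_(i < N) _.
suff : Sg <= h + e.
  move=> SgE; rewrite -subr_ge0.
  have -> : 2 * n%:R * ln 2 - n%:R * Sg - n%:R * (2 * ln 2 - h - e) =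
    n%:R * (h + e - Sg) by ring.
  by rewrite mulr_ge0 ?(ltW nr)// subr_ge0.
apply: (@le_trans _ _ (discrete_rate N (lifted phi (4 / N%:R)) + e / 2)); last first.
  by have := lifted_rate_le phi N8; have := hphi N N0; lra.
have vE i : ((target_east phi n N i)%:R - (block_time n N i)%:R) / n%:R =
    (target_height phi n N i)%:R / n%:R :> R.
  by rewrite /target_east natrD addrC addKr.
have := n0P n n0n (lifted phi (4 / N%:R)) (fun i => (target_height phi n N i)%:R / n%:R)
  (@lifted_lipschitz _ _ _).
move=> /(_ _)/wrap[] => [i _|]; first exact: target_height_close.
move=> /(_ _)/wrap[] => [i _|].
  have [h1 h2] := target_height_step phi N8 Nn i.
  rewrite -mulrBl normrM normfV (gtr0_norm nr) ler_pM2r ?invr_gt0//.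
  rewrite -(ler_nat R) natrD in h1; rewrite -(ler_nat R) natrD in h2.
  by rewrite ler_norml; apply/andP; split; lra.
rewrite ler_norml => /andP[_]; rewrite lerBlDl; apply: le_trans.
rewrite le_eqVlt; apply/orP; left; apply/eqP; apply: eq_bigr => i _.
by rewrite !vE.
Qed.

From mathcomp Require Import finmap.

(** * The large deviation principle *)

Section uniform_avoiders.
Variable R : realType.

Definition avoiders n (A : set (Av231 n)) : seq 'S_n :=
  [seq val s | s <- enum_fset (fset_set A)].

Lemma finite_avoiders n (A : set (Av231 n)) : finite_set A.
Proof. exact: finite_finset. Qed.

Lemma mem_avoiders n (A : set (Av231 n)) s :
  s \in avoiders A <-> exists2 t : Av231 n, A t & val t = s.
Proof.
split=> [/mapP[t + ->]|[t At <-]].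
  rewrite in_fset_set; last exact: finite_avoiders.
  by move=> /set_mem At; exists t.
apply/mapP; exists t => //.
by rewrite in_fset_set ?mem_set//; exact: finite_avoiders.
Qed.

Lemma avoiders_uniq n (A : set (Av231 n)) : uniq (avoiders A).
Proof. by rewrite map_inj_uniq ?fset_uniq//; exact: val_inj. Qed.

Lemma avoiders_setT_gt0 n : (0 < size (avoiders [set: Av231 n]))%N.
Proof.
have : (1%g : 'S_n) \in avoiders [set: Av231 n].
  by apply/mem_avoiders; exists (exist _ 1%g (avoids231_id n)).
by case: avoiders.
Qed.

Lemma unif231E n (A : set (Av231 n)) :
  unif231 R n A =
    ((size (avoiders A))%:R / (size (avoiders [set: Av231 n]))%:R)%:E.
Proof.
have cE (B : set (Av231 n)) : @counting (Av231 n) R B = ((size (avoiders B))%:R)%:E.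
  rewrite /counting asboolT; last exact: finite_avoiders.
  by rewrite size_map.
rewrite /unif231/= /mnormalize/= !cE; case: ifPn => [|_]; last by rewrite cE.
move=> /orP[|/eqP//]; rewrite eqe pnatr_eq0 => /eqP h.
by have := avoiders_setT_gt0 n; rewrite h.
Qed.

Lemma sub_avoiders n (A : set (Av231 n)) (S : seq 'S_n) : uniq S ->
  (forall s, s \in S -> avoids231 s /\ forall t : Av231 n, val t = s -> A t) ->
  (size S <= size (avoiders A))%N.
Proof.
move=> uS HS; apply: uniq_leq_size => // s /HS[avs At].
by apply/mem_avoiders; exists (exist _ s avs) => //; exact: At.
Qed.

End uniform_avoiders.

Section exponential_scale.
Variable R : realType.

Lemma poly_le_exp (M : nat) (e : R) : 0 < e ->
  \forall n \near \oo, (n.*2).+1%:R ^+ M <= expR (n%:R * e).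
Proof.
move=> e0.
(* [expR (n * e)] is the power [2 * (M + 1)] of [expR (c * n) >= 1 + c * n], and
   [(1 + c * n) ^ 2] beats [2 * n + 1]. *)
pose c := e / (2 * M.+1%:R).
have c0 : 0 < c by rewrite divr_gt0// mulr_gt0.
near=> n.
have n0 : 0 < n%:R :> R by rewrite ltr0n; near: n; exact: nbhs_infty_gt.
have nc : 2 / c ^+ 2 < n%:R by near: n; exact: nbhs_infty_gtr.
have h : (n.*2).+1%:R <= (1 + c * n%:R) ^+ 2 :> R.
  rewrite -natr1 -mul2n natrM.
  have : 2 <= c ^+ 2 * n%:R by rewrite mulrC -ler_pdivrMr ?exprn_gt0// ltW.
  have : 0 < c * n%:R by rewrite mulr_gt0.
  nra.
have -> : n%:R * e = (2 * M.+1)%:R * (c * n%:R).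
  by rewrite natrM /c; field; rewrite addrC natr1 pnatr_eq0.
rewrite expRM_natl exprM.
apply: (@le_trans _ _ ((n.*2).+1%:R ^+ M.+1)).
  by rewrite ler_weXn2l// ler1n.
rewrite lerXn2r ?nnegrE ?exprn_ge0 ?expR_ge0//.
apply: le_trans h _; rewrite lerXn2r ?nnegrE ?expR_ge0//.
  by rewrite addr_ge0// mulr_ge0// ltW.
exact: expR_ge1Dx.
Unshelve. all: by end_near. Qed.

Lemma scaled_lne_le n (p c : R) : (0 < n)%N -> 0 <= p -> p <= expR (n%:R * c) ->
  ((n%:R^-1)%:E * lne p%:E <= c%:E)%E.
Proof.
move=> n0 p0 pc; have nr : 0 < n%:R :> R by rewrite ltr0n.
rewrite lee_pdivrMl// -EFinM.
apply: le_trans (_ : lne (expR (n%:R * c))%:E <= _)%E.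
  by rewrite lee_lne ?in_itv/= ?leey ?andbT ?lee_fin// expR_ge0.
by rewrite lne_EFin ?expR_gt0// expRK.
Qed.

Lemma scaled_lne_ge n (p c : R) : (0 < n)%N -> expR (n%:R * c) <= p ->
  (c%:E <= (n%:R^-1)%:E * lne p%:E)%E.
Proof.
move=> n0 pc; have nr : 0 < n%:R :> R by rewrite ltr0n.
have p0 : 0 < p by apply: lt_le_trans pc; exact: expR_gt0.
rewrite lee_pdivlMl// -EFinM lne_EFin// lee_fin -ler_expR.
by rewrite lnK ?posrE.
Qed.

End exponential_scale.

Section LDP.
Variable R : realType.
Implicit Type phi : excursion R.
Let X n (s : Av231 n) : excursion R := rotated_curve R (val s).
Arguments X : clear implicits.

Let total n := size (avoiders [set: Av231 n]).

(** The zero excursion has rate 0, so the avoiders close to it are already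
    numerous enough. *)
Lemma total_ge (e : R) : 0 < e ->
  \forall n \near \oo, expR (n%:R * (2 * ln 2 - e)) <= (total n)%:R :> R.
Proof.
move=> e0; have e2 : 0 < e / 2 by rewrite divr_gt0.
have rate0 N : (0 < N)%N -> discrete_rate N (excursion0 R) <= 0.
  by move=> N0; rewrite /discrete_rate big1 ?mulr0// => i _; rewrite subrr mulr0 J0.
have [N [n0 H]] := count_avoiders_near ltr01 e2 rate0.
near=> n.
have nn0 : (n0 <= n)%N by near: n; exact: nbhs_infty_ge.
have [S [uS HS sS]] := H n nn0.
have poly : (n.*2).+1%:R ^+ N <= expR (n%:R * (e / 2)) by near: n; exact: poly_le_exp.
rewrite -(ler_pM2l (expR_gt0 (n%:R * (e / 2)))) -expRD.
have -> : n%:R * (e / 2) + n%:R * (2 * ln 2 - e) = n%:R * (2 * ln 2 - 0 - e / 2) by field.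
apply: le_trans sS _; apply: ler_pM; [exact: exprn_ge0|exact: ler0n|exact: poly|].
by rewrite ler_nat; apply: sub_avoiders => // s /HS[].
Unshelve. all: by end_near. Qed.

(** All discretized rates are at least 0. *)
Lemma total_le (e : R) : 0 < e ->
  \forall n \near \oo, (total n)%:R <= expR (n%:R * (2 * ln 2 + e)) :> R.
Proof.
move=> e0; have e2 : 0 < e / 2 by rewrite divr_gt0.
have [n0 H] := count_avoiders_rate_ge 0 (ltn0Sn 0) e2.
near=> n.
have nn0 : (n0 <= n)%N by near: n; exact: nbhs_infty_ge.
have /(_ _)/wrap[] := H n nn0 _ (avoiders_uniq [set: Av231 n]).
  move=> s /mem_avoiders[t _ <-]; split; first exact: valP t.
  rewrite /discrete_rate mulr_ge0// ?divr_ge0// sumr_ge0// => i _; exact: J_ge0.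
move=> /le_trans; apply.
have poly : (n.*2).+1%:R ^+ 2 <= expR (n%:R * (e / 2)) by near: n; exact: poly_le_exp.
have -> : n%:R * (2 * ln 2 + e) = n%:R * (e / 2) + n%:R * (2 * ln 2 - 0 + e / 2) by field.
by rewrite expRD ler_pM2r ?expR_gt0.
Unshelve. all: by end_near. Qed.

Lemma avoiders_rate_gt N (a e : R) : (0 < N)%N -> 0 < e ->
  \forall n \near \oo, forall A : set (Av231 n),
    (forall s, A s -> a < discrete_rate N (X n s)) ->
  (size (avoiders A))%:R <= expR (n%:R * (2 * ln 2 - a + e)).
Proof.
move=> N0 e0; have e2 : 0 < e / 2 by rewrite divr_gt0.
have [n0 H] := count_avoiders_rate_ge a N0 e2.
near=> n => A HA.
have nn0 : (n0 <= n)%N by near: n; exact: nbhs_infty_ge.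
have /(_ _)/wrap[] := H n nn0 _ (avoiders_uniq A).
  move=> s /mem_avoiders[t At <-]; split; first exact: valP t.
  by rewrite ltW//; exact: HA.
move=> /le_trans; apply.
have poly : (n.*2).+1%:R ^+ N.+1 <= expR (n%:R * (e / 2)) by near: n; exact: poly_le_exp.
have -> : n%:R * (2 * ln 2 - a + e) = n%:R * (e / 2) + n%:R * (2 * ln 2 - a + e / 2) by field.
by rewrite expRD ler_pM2r ?expR_gt0.
Unshelve. all: by end_near. Qed.

End LDP.

Section LDP.
Variable R : realType.
Implicit Type phi : excursion R.
Let X n (s : Av231 n) : excursion R := rotated_curve R (val s).
Arguments X : clear implicits.

(** By compactness, since the discretized rates come arbitrarily close to [H231]. *)
Lemma closed_cover_rate (F : set (excursion R)) (a : R) : closed F ->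
    (a%:E < ereal_inf (@H231 R @` F))%E ->
  exists D : {fset nat}, (forall N, N \in D -> (0 < N)%N) /\
    forall phi, F phi -> exists2 N, N \in D & a < discrete_rate N phi.
Proof.
move=> clF aF.
have := subclosed_compact clF (@excursion_compact R) (@subsetT _ _).
rewrite compact_cover => /(_ nat [set N | (0 < N)%N]
  (fun N => [set phi : excursion R | a < discrete_rate N phi])).
move=> /(_ _)/wrap[]; first by move=> N /= N0; exact: open_discrete_rate_gt.
move=> /(_ _)/wrap[].
  move=> phi Fphi; have : (a%:E < H231 phi)%E.
    by apply: lt_le_trans aF _; apply: ereal_inf_lbound; exists phi.
  by move=> /H231_gt_discrete_rate[N N0 aN]; exists N.
move=> [D sD FD]; exists D; split => [N ND|phi /FD[N ND aN]]; last by exists N.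
exact: set_mem (sD N ND).
Qed.

Lemma LDP_upper_bound (F : set (excursion R)) (a : R) : closed F ->
    (a%:E < ereal_inf (@H231 R @` F))%E ->
  (limn_esup (fun n => (n%:R^-1)%:E * lne (unif231 R n (X n @^-1` F))) <= (- a)%:E)%E.
Proof.
move=> clF aF; have [D [D0 FD]] := closed_cover_rate clF aF.
apply/lee_addgt0Pr => e e0; rewrite -EFinD; apply: near_limn_esup_le.
have e3 : 0 < e / 3 by rewrite divr_gt0.
have nearD : \forall n \near \oo, (\bigcap_(N in [set` D])
    [set n | forall A : set (Av231 n), (forall s, A s -> a < discrete_rate N (X n s)) ->
       (size (avoiders A))%:R <= expR (n%:R * (2 * ln 2 - a + e / 3))]) n.
  by apply: filter_bigI => N ND; apply: avoiders_rate_gt => //; exact: D0.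
near=> n.
have n0 : (0 < n)%N by near: n; exact: nbhs_infty_gt.
have Dn : (#|` D| <= n)%N by near: n; exact: nbhs_infty_ge.
have poly : (n.*2).+1%:R ^+ 1 <= expR (n%:R * (e / 3)) by near: n; exact: poly_le_exp.
have tot : expR (n%:R * (2 * ln 2 - e / 3)) <= (size (avoiders [set: Av231 n]))%:R :> R.
  by near: n; exact: total_ge.
have nD : (\bigcap_(N in [set` D])
    [set n | forall A : set (Av231 n), (forall s, A s -> a < discrete_rate N (X n s)) ->
       (size (avoiders A))%:R <= expR (n%:R * (2 * ln 2 - a + e / 3))]) n.
  by near: n; exact: nearD.
rewrite unif231E; apply: scaled_lne_le; [by []|by rewrite divr_ge0|].
rewrite ler_pdivrMr ?ltr0n ?avoiders_setT_gt0//.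
apply: (@le_trans _ _ (expR (n%:R * (- a + e)) * expR (n%:R * (2 * ln 2 - e / 3)))); last first.
  by rewrite ler_pM2l ?expR_gt0.
have -> : expR (n%:R * (- a + e)) * expR (n%:R * (2 * ln 2 - e / 3)) =
    expR (n%:R * (e / 3)) * expR (n%:R * (2 * ln 2 - a + e / 3)) :> R.
  by rewrite -!expRD; congr expR; field.
pose AN N : set (Av231 n) := [set s | a < discrete_rate N (X n s)].
apply: (@le_trans _ _ (\sum_(N <- D) (size (avoiders (AN N)))%:R)).
  rewrite -natr_sum ler_nat.
  have -> : (\sum_(N <- D) size (avoiders (AN N)))%N =
      size (flatten [seq avoiders (AN N) | N <- D]).
    by rewrite size_flatten /shape -map_comp sumnE big_map.
  apply: uniq_leq_size; first exact: avoiders_uniq.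
  move=> s /mem_avoiders[t /FD[N ND aN] <-].
  apply/flattenP; exists (avoiders (AN N)); first exact: map_f.
  by apply/mem_avoiders; exists t.
apply: (@le_trans _ _ (\sum_(N <- D) expR (n%:R * (2 * ln 2 - a + e / 3)))).
  rewrite big_seq [leRHS]big_seq; apply: ler_sum => N ND.
  by apply: (nD N ND) => s.
rewrite big_const_seq count_predT iter_addr addr0 -[leLHS]mulr_natl.
rewrite ler_pM2r ?expR_gt0//; apply: le_trans poly.
by rewrite expr1 ler_nat (leq_trans Dn)// -addnn ltnW// ltnS leq_addr.
Unshelve. all: by end_near. Qed.

Lemma LDP_lower_bound (O : set (excursion R)) phi : open O -> O phi ->
  (- H231 phi <=
    limn_einf (fun n => (n%:R^-1)%:E * lne (unif231 R n (X n @^-1` O))))%E.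
Proof.
move=> oO Ophi; case HE : (H231 phi) (H231_ge0 phi) => [h| |//] _; last first.
  by rewrite /= leNye.
have rate_h N : (0 < N)%N -> discrete_rate N phi <= h.
  by move=> N0; rewrite -lee_fin -HE; exact: discrete_rate_le_H231.
have [r r0 rO] : exists2 r, 0 < r & ball phi r `<=` O.
  by have : nbhs phi O by [exact: open_nbhs_nbhs]; rewrite -nbhs_ballE => -[r /= r0 rO]; exists r.
apply/lee_subgt0Pr => e e0; rewrite -EFinN -EFinB; apply: near_limn_einf_ge.
have e3 : 0 < e / 3 by rewrite divr_gt0.
have [N [n1 H]] := count_avoiders_near r0 e3 rate_h.
near=> n.
have n0 : (0 < n)%N by near: n; exact: nbhs_infty_gt.
have n1n : (n1 <= n)%N by near: n; exact: nbhs_infty_ge.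
have poly : (n.*2).+1%:R ^+ N <= expR (n%:R * (e / 3)) by near: n; exact: poly_le_exp.
have tot : (size (avoiders [set: Av231 n]))%:R <= expR (n%:R * (2 * ln 2 + e / 3)) :> R.
  by near: n; exact: total_le.
have [S [uS HS sS]] := H n n1n.
have SO : (size S <= size (avoiders (X n @^-1` O)))%N.
  apply: sub_avoiders => // s /HS[avs ds]; split => // t ts; apply: rO.
  rewrite excursion_ballE/= /X ts; apply: le_lt_trans ds.
  by apply: excursion_sup_dist_le => u _ _; rewrite distrC excursion_le_sup_dist.
rewrite unif231E; apply: scaled_lne_ge => //.
rewrite ler_pdivlMr ?ltr0n ?avoiders_setT_gt0//.
apply: (@le_trans _ _ (expR (n%:R * (- h - e)) * expR (n%:R * (2 * ln 2 + e / 3)))).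
  by rewrite ler_pM2l ?expR_gt0.
rewrite -(ler_pM2l (expR_gt0 (n%:R * (e / 3)))) -!expRD.
have -> : n%:R * (e / 3) + (n%:R * (- h - e) + n%:R * (2 * ln 2 + e / 3)) =
  n%:R * (2 * ln 2 - h - e / 3) by field.
apply: le_trans sS _; apply: ler_pM; [exact: exprn_ge0|exact: ler0n|exact: poly|].
by rewrite ler_nat.
Unshelve. all: by end_near. Qed.

End LDP.

Theorem proposition4 (R : realType) :
  @satisfies_LDP R (excursion R) _ Av231 (unif231 R)
    (fun n (s : Av231 n) => rotated_curve R (val s))
    (fun n => n%:R%R) (@H231 R).
Proof.
split.
- by [].
- exact: cvgr_idn.
- by split; [exact: H231_ge0|exact: H231_lsc].
- move=> F clF; rewrite leeNr.
  have le a : (a%:E < ereal_inf (@H231 R @` F))%E -> (a%:E <=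
     - limn_esup (fun n => (n%:R^-1)%:E *
         lne (unif231 R n ((fun s : Av231 n => rotated_curve R (val s)) @^-1` F))))%E.
    by move=> aF; rewrite leeNr -EFinN; exact: LDP_upper_bound.
  case IE : (ereal_inf _) le => [i| |] le; last by rewrite leNye.
    apply/lee_subgt0Pr => e e0; rewrite -EFinB; apply: le.
    by rewrite lte_fin ltrBlDr ltrDl.
  rewrite leye_eq; apply/eqP/eq_infty => a; apply: le; exact: ltry.
- move=> O oO; rewrite leeNl; apply: le_ereal_inf_tmp => _ [phi Ophi <-].
  by rewrite leeNl; exact: LDP_lower_bound.
Qed.
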